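(* Let $\theta>0$, let $\mathbf P^+$ be a GEM$(\theta)$ sequence, and let $\tilde Q$ be a stochastic matrix on the discrete space $\mathcal X$ without absorbing states and with stationary distribution $\mu$. Let $\mathbf T'$ be a homogeneous Markov chain with kernel $\tilde Q$ and initial law $\mu$, independent of $\mathbf P^+$. Set $\tilde G=\theta(\tilde Q-I)$, $\tilde G'_{i,j}=\frac{\mu_j}{\mu_i}\tilde G_{j,i}\mathbb 1(\mu_i\ne0)$ and $\tilde Q'=I+\tilde G'/\theta$. Then $$\Big\langle\sum_{j=1}^\infty P^+_j\delta_{T'_j}(l):l\in\mathcal X\Big\rangle\overset d=\nu,$$ where $\nu$ is the distributional limit of the empirical occupation measures $\nu_n=\langle\frac1n\sum_{j=1}^n\delta_{T_j}(l)\rangle_{l\in\mathcal X}$ of the time-inhomogeneous Markov chain $\mathbf T$ with kernels $K_n=I+\frac{\tilde G'}{n}\mathbb 1(n>M)$ (for $M\in\mathbb N$ as in the time-inhomogeneous theorem, applied with generator $\tilde G'$) started from any distribution $\pi$ satisfying $\pi^t(\tilde Q')^n\to\mu^t$ entrywise.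
   Context: GEM$(\theta)$: $P_j=X_j\prod_{i<j}(1-X_i)$ with i.i.d. Beta$(1,\theta)$ fractions $X_j$. Time-inhomogeneous chain with kernels $K_n$: $\mathbb P(T_{n+1}=j\mid T_n=i)=K_n(i,j)$, with $M$ an integer exceeding $\inf\{r>0:I+r^{-1}\tilde G'\text{ non-negative}\}$. Convergence in distribution of $\nu_n$ is in the coordinatewise topology on probability vectors on $\mathcal X$. *)

(* Defs.v *)
From HB Require Import structures.
From mathcomp Require Import all_boot all_order all_algebra.
From mathcomp Require Import all_classical all_reals all_analysis.
Set Implicit Arguments. Unset Strict Implicit. Unset Printing Implicit Defensive.
Import Order.TTheory GRing.Theory Num.Theory.
Import numFieldNormedType.Exports.
Local Open Scope classical_set_scope.
Local Open Scope ring_scope.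

Section Defs.
Variable R : realType.
Variable X : countType.

Definition prob_vec (v : X -> R) : Prop :=
  (forall i, 0 <= v i) /\ (\esum_(i in [set: X]) (v i)%:E = 1)%E.

Definition stochastic (Q : X -> X -> R) : Prop :=
  (forall i j, 0 <= Q i j) /\
  (forall i, (\esum_(j in [set: X]) (Q i j)%:E = 1)%E).

Definition vmul (v : X -> R) (Q : X -> X -> R) : X -> R :=
  fun l => fine (\esum_(i in [set: X]) (v i * Q i l)%:E).

Definition vpow (v : X -> R) (Q : X -> X -> R) (n : nat) : X -> R :=
  iter n (fun w => vmul w Q) v.

Definition stationary (Q : X -> X -> R) (mu : X -> R) : Prop :=
  prob_vec mu /\ vmul mu Q = mu.

Definition no_absorbing (Q : X -> X -> R) : Prop := forall i, Q i i != 1.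

Definition idm (i j : X) : R := (i == j)%:R.

Definition Gt (theta : R) (Q : X -> X -> R) : X -> X -> R :=
  fun i j => theta * (Q i j - idm i j).

Definition Gtp (theta : R) (Q : X -> X -> R) (mu : X -> R) : X -> X -> R :=
  fun i j => if mu i != 0 then mu j / mu i * Gt theta Q j i else 0.

Definition Qtp (theta : R) (Q : X -> X -> R) (mu : X -> R) : X -> X -> R :=
  fun i j => idm i j + Gtp theta Q mu i j / theta.

Definition M_threshold (G : X -> X -> R) : R :=
  inf [set r : R | 0 < r /\ forall i j, 0 <= idm i j + G i j / r].

Definition Kn (G : X -> X -> R) (M n : nat) : X -> X -> R :=
  fun i j => idm i j + (if (M < n)%N then G i j / n%:R else 0).

Variables (d : measure_display) (Omega : measurableType d)
          (P : probability Omega R).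

(* time-inhomogeneous Markov chain S_0, S_1, ... with initial law pi and
   P(S_{k+1} = j | S_k = i) = K k i j, given through its finite-dimensional
   distributions *)
Definition markov_chain (pi : X -> R) (K : nat -> X -> X -> R)
    (S : nat -> Omega -> X) : Prop :=
  (forall k x, measurable (S k @^-1` [set x])) /\
  forall (n : nat) (x : nat -> X),
    P [set w | forall k, (k <= n)%N -> S k w = x k] =
    (pi (x 0%N) * \prod_(k < n) K k (x k) (x k.+1))%:E.

Definition beta1_law (theta : R) (B : set R) : \bar R :=
  (\int[lebesgue_measure]_(x in B `&` `]0%R, 1%R[)
      (theta * powR (1 - x) (theta - 1))%:E)%E.

Definition iid_beta1 (theta : R) (Xb : nat -> Omega -> R) : Prop :=
  (forall k, measurable_fun setT (Xb k)) /\
  forall (n : nat) (B : nat -> set R), (forall k, measurable (B k)) ->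
    P [set w | forall k, (k <= n)%N -> B k (Xb k w)] =
    (\prod_(k < n.+1) beta1_law theta (B k))%E.

Definition GEM (theta : R) (Pp : nat -> Omega -> R) : Prop :=
  exists Xb : nat -> Omega -> R, iid_beta1 theta Xb /\
    forall j w, Pp j w = Xb j w * \prod_(i < j) (1 - Xb i w).

Definition indep_seq (T : nat -> Omega -> X) (Pp : nat -> Omega -> R) : Prop :=
  forall (n : nat) (x : nat -> X) (B : nat -> set R),
    (forall k, measurable (B k)) ->
    let A := [set w | forall k, (k <= n)%N -> T k w = x k] in
    let C := [set w | forall k, (k <= n)%N -> B k (Pp k w)] in
    P (A `&` C) = (P A * P C)%E.

End Defs.

Definition occupation (R : realType) (X : countType) (T : Type)
    (S : nat -> T -> X) (n : nat) (w : T) : X -> R :=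
  fun l => n%:R^-1 * \sum_(k < n) (S k w == l)%:R.

Definition gem_mixture (R : realType) (X : countType) (T : Type)
    (Pp : nat -> T -> R) (Tp : nat -> T -> X) (w : T) : X -> R :=
  fun l => fine (\sum_(j <oo) ((Pp j w) * (Tp j w == l)%:R)%:E)%E.

(* Main.v *)
(* For n > M, K_n = (1 - theta/n) I + (theta/n) Q', where Q' is the time reversal of Q.
   The pair (nu_n, T_n) is a Markov chain whose n-th transition operator P_n maps
   h(v, i) to the sum over j of K_n(i, j) h((n v + delta_j)/(n+1), j).  It does not
   increase the sup norm and multiplies Lipschitz constants in v by n/(n+1), so
   P_n ... P_(N-1) h is almost a function of i alone when N is much larger than n.
   The law lambda of (sum_j P_j delta_(T'_j), T'_0) is almost invariant under P_n:
   the Beta(1,theta) law of X_0 conditioned on X_0 >= 1/(n+1) is the law of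
   1/(n+1) + n/(n+1) X_0, which accounts for the steps without jump, while on
   X_0 < 1/(n+1), an event of probability close to theta/n, the first stick may be
   dropped, and reversing the T'-chain turns the remaining mixture into Q' h.  The
   error is O(1/n^2), hence summable.  Since T_n converges to mu in total variation,
   E h(nu_n, T_n) tends to lambda(h) for Lipschitz h.  A bounded continuous function
   is reached from below by inf-convolutions. *)
Require Import Defs.
From HB Require Import structures.
From mathcomp Require Import all_boot all_order all_algebra.
From mathcomp Require Import all_classical all_reals all_analysis.
From mathcomp Require Import measurable_realfun ring lra.
Set Implicit Arguments.
Unset Strict Implicit.
Unset Printing Implicit Defensive.
Import Order.TTheory GRing.Theory Num.Theory.
Import numFieldNormedType.Exports.
Local Open Scope classical_set_scope.
Local Open Scope ring_scope.

(** * Countable laws and bounded convergence *)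

(** The assumption on [pi] concerns powers of the fixed kernel [Q'], not the inhomogeneous chain.
    Convergence of [T_n] comes from a descent on [m] in the distance between [E (Q'^m g)(T_n)] and
    [mu(g)]. For large [m] it is small, uniformly over [n] beyond a threshold; and the factors
    [1 - theta/n] pull level [m] towards level [m + 1], completely in the limit because
    [sum theta/n] diverges. Since [M] may lie below [theta], the coefficient [1 - theta/n] can be
    negative for early [n]; kernel identities are therefore written with nonnegative terms on both
    sides. The joint laws are given only through finite paths and rectangles. Each one is reduced to
    variables with countably many values (finite paths, sticks rounded down to the grid of mesh
    [1/(m+1)]), for which integrals are sums; bounded convergence then refines the grid. Sticks lie
    in []0,1[] only almost surely. They are clipped into it, so that pathwise bounds hold
    everywhere, and the clipping is undone on a null set at the end. *)

Lemma ge0_le_norm (R : realDomainType) (x C : R) : 0 <= x <= C -> `|x| <= C.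
Proof. by case/andP => x0 xC; rewrite ger0_norm. Qed.

Lemma measurable_countable_preimage d (T : measurableType d) (Y : countType)
    (U : T -> Y) : (forall y, measurable (U @^-1` [set y])) ->
  forall A : set Y, measurable (U @^-1` A).
Proof.
move=> mU A.
have -> : U @^-1` A = \bigcup_n (if pickle_inv n is Some y
    then (if `[< A y >] then U @^-1` [set y] else set0) else set0).
  apply/seteqP; split => [w /= Aw|w [n _]].
    by exists (pickle (U w)) => //; rewrite pickleK_inv asboolT.
  by case: (pickle_inv n) => [y|//]; case: ifPn => // /asboolP Ay /= ->.
apply: bigcup_measurable => n _; case: (pickle_inv n) => // y.
by case: ifPn.
Qed.

(** Preimages are countable unions of fibres, so every functional of a finite path is measurable. *)
Lemma measurable_fun_countable d (T : measurableType d) d' (T' : sigmaRingType d')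
    (Y : countType) (U : T -> Y) (g : Y -> T') :
  (forall y, measurable (U @^-1` [set y])) ->
  measurable_fun setT (fun w => g (U w)).
Proof.
move=> mU _ B mB; rewrite setTI.
exact: (@measurable_countable_preimage _ _ _ U mU (g @^-1` B)).
Qed.

Lemma esum_countTypeE (R : realType) (X : countType) (a : X -> \bar R) :
  (forall x, 0 <= a x)%E ->
  (\esum_(x in [set: X]) a x = \sum_(n <oo) oapp a 0 (pickle_inv n))%E.
Proof.
move=> a0.
have b0 n : (0 <= oapp a 0 (pickle_inv n))%E by case: (pickle_inv n).
rewrite nneseries_esumT//.
rewrite (@esumID R nat (range (@pickle X)))// [X in (_ + X)%E]esum1 ?adde0.
  rewrite setTI esum_image; last by move=> x y _ _; exact: (pcan_inj pickleK).
  by apply: eq_esum => x _; rewrite pickleK_inv.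
move=> n [_ nP]; case E : (pickle_inv n) => [x|//]; exfalso; apply: nP.
by exists x => //; have := @pickle_invK X n; rewrite E.
Qed.

Lemma integral_countable d (T : measurableType d) (R : realType)
    (mu : {measure set T -> \bar R}) (D : set T) (Y : countType) (U : T -> Y)
    (g : Y -> \bar R) :
  measurable D -> (forall y, measurable (U @^-1` [set y])) ->
  (forall y, 0 <= g y)%E ->
  (\int[mu]_(w in D) g (U w) =
   \esum_(y in [set: Y]) (g y * mu (D `&` U @^-1` [set y])))%E.
Proof.
move=> mD mU g0.
pose F n := if pickle_inv n is Some y then D `&` U @^-1` [set y] else set0.
have mF n : measurable (F n).
  by rewrite /F; case: (pickle_inv n) => // y; exact: measurableI.
have DF : D = \bigcup_n F n.
  apply/seteqP; split => [w Dw|w [n _]]; last first.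
    by rewrite /F; case: (pickle_inv n) => [y []|].
  by exists (pickle (U w)) => //; rewrite /F pickleK_inv.
have tF : trivIset setT F.
  move=> i j _ _; rewrite /F => -[w []].
  have := @pickle_invK Y i; have := @pickle_invK Y j.
  case: (pickle_inv i) => [y|_ _ []]; case: (pickle_inv j) => [z|_ _ _ []] //=.
  by move=> <- <- [_ /= <-] [_ /= <-].
rewrite {1}DF ge0_integral_bigcup//; last first.
  by apply: (@measurable_funS _ _ _ _ setT) => //; exact: measurable_fun_countable.
rewrite esum_countTypeE; last by move=> y; rewrite mule_ge0.
apply: eq_eseriesr => n _; rewrite /F; case: (pickle_inv n) => [y|] /=.
  rewrite (@eq_integral _ _ _ mu _ (cst (g y))).
    by rewrite integral_cst//; exact: measurableI.
  by move=> w; rewrite inE => -[_ /= ->].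
by rewrite integral_set0.
Qed.

(** This takes the place of Fubini and of conditional expectation. Letting [U1] and [U2] be
    different variables with the same values makes it possible to trade a shifted path for an
    unshifted one in the time reversal. *)
Lemma integral_kernel d1 (T1 : measurableType d1) d2 (T2 : measurableType d2)
    (R : realType) (P1 : probability T1 R) (P2 : probability T2 R) (A B : countType)
    (U1 : T1 -> A) (V1 : T1 -> B) (U2 : T2 -> A) (k : A -> B -> R)
    (g : A -> B -> \bar R) :
  (forall a, measurable (U1 @^-1` [set a])) ->
  (forall b, measurable (V1 @^-1` [set b])) ->
  (forall a, measurable (U2 @^-1` [set a])) ->
  (forall a b, 0 <= k a b) -> (forall a b, 0 <= g a b)%E ->
  (forall a b, P1 (U1 @^-1` [set a] `&` V1 @^-1` [set b]) =
     (P2 (U2 @^-1` [set a]) * (k a b)%:E)%E) ->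
  (\int[P1]_w g (U1 w) (V1 w) =
   \int[P2]_w \esum_(b in [set: B]) ((k (U2 w) b)%:E * g (U2 w) b))%E.
Proof.
move=> mU1 mV1 mU2 k0 g0 H.
rewrite (@integral_countable _ _ _ P1 setT (A * B)%type
  (fun w => (U1 w, V1 w)) (fun ab => g ab.1 ab.2))//; last first.
  move=> [a b]; rewrite (_ : _ @^-1` _ = U1 @^-1` [set a] `&` V1 @^-1` [set b]).
    exact: measurableI.
  by apply/seteqP; split => w /=; [case=> -> ->|case=> -> ->].
rewrite (@integral_countable _ _ _ P2 setT A U2
  (fun a => \esum_(b in [set: B]) ((k a b)%:E * g a b)%E))//; last first.
  by move=> a; apply: esum_ge0 => b _; rewrite mule_ge0 ?lee_fin.
pose c a b := (g a b * P1 (U1 @^-1` [set a] `&` V1 @^-1` [set b]))%E.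
transitivity (\esum_(p in [set: A] `*`` (fun=> [set: B])) c p.1 p.2)%E.
  rewrite (_ : [set: A * B] = [set: A] `*`` (fun=> [set: B])); last first.
    by apply/seteqP; split.
  apply: eq_esum => -[a b] _; rewrite /c setTI; congr (_ * P1 _)%E.
  by apply/seteqP; split => w /=; [case=> -> ->|case=> -> ->].
rewrite -(@esum_esum R A B setT (fun=> setT) c); last first.
  by move=> a b _ _; rewrite mule_ge0.
apply: eq_esum => a _; rewrite setTI [RHS]muleC.
rewrite (@esum_countTypeE R B (c a)); last by move=> b; rewrite /c mule_ge0.
rewrite (@esum_countTypeE R B (fun b => (k a b)%:E * g a b)%E); last first.
  by move=> b; rewrite mule_ge0 ?lee_fin.
have nn n : (0 <= oapp (fun b => (k a b)%:E * g a b) 0 (pickle_inv n))%E.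
  by case: (pickle_inv n) => //= b; rewrite mule_ge0 ?lee_fin.
have P2fin : P2 (U2 @^-1` [set a]) \is a fin_num by exact: fin_num_measure.
rewrite -[X in _ = (X * _)%E](fineK P2fin) -nneseriesZl//.
apply: eq_eseriesr => n _; case: (pickle_inv n) => [b|] /=; last by rewrite mule0.
by rewrite /c H -{1}(fineK P2fin) muleC muleA.
Qed.

Lemma bounded_Rintegrable d (T : measurableType d) (R : realType)
    (P : probability T R) (D : set T) (f : T -> R) (C : R) :
  measurable D -> measurable_fun setT f -> (forall w, `|f w| <= C) ->
  P.-integrable D (EFin \o f).
Proof.
move=> mD mf fC; apply: measurable_bounded_integrable => //.
- exact: le_lt_trans (probability_le1 P mD) (ltry _).
- by apply: (@measurable_funS _ _ _ _ setT).
- exists C; split; first exact: num_real.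
  by move=> M CM w _; apply: le_trans (fC w) (ltW CM).
Qed.

Lemma cvg_Rintegral_bounded d (T : measurableType d) (R : realType)
    (P : probability T R) (D : set T) (f_ : nat -> T -> R) (f : T -> R) (C : R) :
  measurable D -> (forall n, measurable_fun setT (f_ n)) ->
  (forall n w, `|f_ n w| <= C) ->
  (forall w, (fun n => f_ n w) @ \oo --> f w) ->
  [/\ measurable_fun setT f, (forall w, `|f w| <= C) &
   (fun n => \int[P]_(w in D) f_ n w) @ \oo --> \int[P]_(w in D) f w].
Proof.
move=> mD mf fC fcvg.
have mlim : measurable_fun setT f.
  apply/measurable_EFinP.
  apply: (@emeasurable_fun_cvg _ _ _ setT (fun n => EFin \o f_ n)) => //.
    by move=> n; exact/measurable_EFinP.
  by move=> w _; apply: cvg_EFin; [exact: nearW|exact: fcvg].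
have fC' w : `|f w| <= C.
  apply: (cvgr_to_le (cvg_norm (fcvg w))); apply: nearW => n; exact: fC.
split => //.
have [] := @dominated_convergence _ T R P D mD (fun n => EFin \o f_ n)
  (EFin \o f) (cst C%:E).
- by move=> n; apply/measurable_EFinP; exact: measurable_funS (mf n).
- by apply/measurable_EFinP; exact: measurable_funS mlim.
- by apply: aeW => w _; apply: cvg_EFin; [exact: nearW|exact: fcvg].
- by apply: (@bounded_Rintegrable _ _ _ _ _ (cst C) `|C|).
- by apply: aeW => w n _; rewrite /= lee_fin.
move=> _ _ H; rewrite /Rintegral; apply: fine_cvg; rewrite fineK//.
apply: integrable_fin_num => //; exact: bounded_Rintegrable fC'.
Qed.

(** * Averages against a probability vector *)

(** Test functions are kept in [[0, C]] so that this is a sum of nonnegative terms with a finite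
    value, which [fine] merely extracts. *)
Definition ev (R : realType) (X : countType) (p g : X -> R) : R :=
  fine (\esum_(j in [set: X]) (p j * g j)%:E)%E.

Lemma esumZl (R : realType) (X : countType) (c : R) (a : X -> \bar R) :
  (forall x, 0 <= a x)%E -> 0 <= c ->
  (\esum_(x in [set: X]) (c%:E * a x) = c%:E * \esum_(x in [set: X]) a x)%E.
Proof.
move=> a0 c0; rewrite (@esum_countTypeE R X a)// esum_countTypeE; last first.
  by move=> x; rewrite mule_ge0.
rewrite -nneseriesZl//; last by move=> n _; case: (pickle_inv n).
by apply: eq_eseriesr => n _; case: (pickle_inv n) => //=; rewrite mule0.
Qed.

Lemma ev_fin (R : realType) (X : countType) (p g : X -> R) (C : R) :
  prob_vec p -> (forall j, 0 <= g j <= C) ->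
  (\esum_(j in [set: X]) (p j * g j)%:E = (ev p g)%:E)%E.
Proof.
move=> [p0 p1] gC; rewrite /ev fineK// ge0_fin_numE; last first.
  by apply: esum_ge0 => j _; rewrite lee_fin mulr_ge0// (andP (gC j)).1.
have C0 : 0 <= `|C| by [].
apply: (@le_lt_trans _ _ (\esum_(j in [set: X]) (`|C|%:E * (p j)%:E)%E)).
  apply: le_esum => j _; rewrite -EFinM lee_fin mulrC ler_wpM2r//.
  by apply: le_trans (ler_norm _); case/andP: (gC j).
by rewrite esumZl// ?p1 ?mule1 ?ltry// => x; rewrite lee_fin.
Qed.

Lemma ev_ge0 (R : realType) (X : countType) (p g : X -> R) :
  prob_vec p -> (forall j, 0 <= g j) -> 0 <= ev p g.
Proof.
move=> [p0 _] g0; apply: fine_ge0.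
by apply: esum_ge0 => j _; rewrite lee_fin mulr_ge0.
Qed.

Lemma ev_cst (R : realType) (X : countType) (p : X -> R) (c : R) :
  prob_vec p -> 0 <= c -> ev p (fun=> c) = c.
Proof.
move=> [p0 p1] c0; rewrite /ev.
under eq_esum do rewrite mulrC EFinM.
by rewrite esumZl// ?p1 ?mule1// => x; rewrite lee_fin.
Qed.

Lemma evD (R : realType) (X : countType) (p g h : X -> R) (C : R) :
  prob_vec p -> (forall j, 0 <= g j <= C) -> (forall j, 0 <= h j <= C) ->
  ev p (fun j => g j + h j) = ev p g + ev p h.
Proof.
move=> pp gC hC; rewrite {1}/ev.
under eq_esum do rewrite mulrDr EFinD.
rewrite esumD; last 2 first.
- by move=> j _; rewrite lee_fin mulr_ge0 ?pp.1// (andP (gC j)).1.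
- by move=> j _; rewrite lee_fin mulr_ge0 ?pp.1// (andP (hC j)).1.
by rewrite (ev_fin pp gC) (ev_fin pp hC).
Qed.

Lemma evZ (R : realType) (X : countType) (p g : X -> R) (c C : R) :
  prob_vec p -> (forall j, 0 <= g j <= C) -> 0 <= c ->
  ev p (fun j => c * g j) = c * ev p g.
Proof.
move=> pp gC c0; rewrite {1}/ev.
under eq_esum do rewrite mulrCA EFinM.
rewrite esumZl//; last first.
  by move=> j; rewrite lee_fin mulr_ge0 ?pp.1// (andP (gC j)).1.
by rewrite (ev_fin pp gC).
Qed.

Lemma ev_le (R : realType) (X : countType) (p g h : X -> R) (C e : R) :
  prob_vec p -> (forall j, 0 <= g j <= C) -> (forall j, 0 <= h j <= C) ->
  0 <= e -> (forall j, g j <= h j + e) -> ev p g <= ev p h + e.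
Proof.
move=> pp gC hC e0 gh.
have C0 : 0 <= `|C| by [].
have hC' j : 0 <= h j <= `|C| + e.
  case/andP: (hC j) => -> /= hj; rewrite (le_trans hj)//.
  by rewrite (le_trans (ler_norm C))// lerDl.
have eC' (j : X) : 0 <= e <= `|C| + e by rewrite e0 lerDr.
rewrite -[X in _ <= _ + X](ev_cst pp e0) -(evD pp hC' eC').
have hD j : 0 <= h j + e <= C + e.
  by case/andP: (hC j) => h0 hj; rewrite addr_ge0//= lerD2r.
rewrite -lee_fin -(ev_fin pp gC) -(ev_fin pp hD).
by apply: le_esum => j _; rewrite lee_fin ler_wpM2l// pp.1.
Qed.

Lemma ev_bound (R : realType) (X : countType) (p g : X -> R) (C : R) :
  prob_vec p -> (forall j, 0 <= g j <= C) -> 0 <= ev p g <= C.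
Proof.
move=> pp gC; rewrite ev_ge0//=; last by move=> j; case/andP: (gC j).
have [X0|/forallNP X0] := pselect (exists x : X, True).
  case: X0 => x _; have C0 : 0 <= C by case/andP: (gC x); exact: le_trans.
  have : ev p g <= ev p (fun=> 0) + C.
    apply: (@ev_le _ _ p g _ C) => // [j|j]; first by rewrite lexx.
    by rewrite add0r; case/andP: (gC j).
  by rewrite (ev_cst pp (lexx 0)) add0r.
exfalso; case: pp => _; rewrite esum1; last by move=> i; case: (X0 i).
by move=> /eqP; rewrite eq_sym onee_eq0.
Qed.

Lemma ev_dist (R : realType) (X : countType) (p g h : X -> R) (C e : R) :
  prob_vec p -> (forall j, 0 <= g j <= C) -> (forall j, 0 <= h j <= C) ->
  (forall j, `|g j - h j| <= e) -> `|ev p g - ev p h| <= e.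
Proof.
move=> pp gC hC gh.
have [[x _]|/forallNP X0] := pselect (exists x : X, True); last first.
  exfalso; case: pp => _; rewrite esum1; last by move=> i; case: (X0 i).
  by move=> /eqP; rewrite eq_sym onee_eq0.
have e0 : 0 <= e by apply: le_trans (gh x).
have H1 : ev p g <= ev p h + e.
  apply: (ev_le pp gC hC e0) => j.
  by have := gh j; rewrite ler_norml => /andP[]; lra.
have H2 : ev p h <= ev p g + e.
  apply: (ev_le pp hC gC e0) => j.
  by have := gh j; rewrite ler_norml => /andP[]; lra.
by rewrite ler_norml; apply/andP; split; lra.
Qed.

(** The plus signs on both sides keep every [esum] nonnegative; this carries [Kn_add] over to
    averages even when [1 - a] is negative. *)
Lemma ev_comb (R : realType) (X : countType) (p1 p2 p3 p4 g : X -> R) (a C : R) :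
  prob_vec p1 -> prob_vec p2 -> prob_vec p3 -> prob_vec p4 ->
  (forall j, 0 <= g j <= C) -> 0 <= a ->
  (forall j, p1 j + a * p2 j = p3 j + a * p4 j) ->
  ev p1 g + a * ev p2 g = ev p3 g + a * ev p4 g.
Proof.
move=> pp1 pp2 pp3 pp4 gC a0 H.
have g0 j : 0 <= g j by case/andP: (gC j).
have E q1 q2 : prob_vec q1 -> prob_vec q2 ->
    (\esum_(j in [set: X]) ((q1 j + a * q2 j) * g j)%:E)%E
      = (ev q1 g + a * ev q2 g)%:E.
  move=> pq1 pq2; under eq_esum do rewrite mulrDl -mulrA EFinD [(a * _)%:E]EFinM.
  rewrite esumD.
  - rewrite esumZl// ?(ev_fin pq1 gC) ?(ev_fin pq2 gC)//.
    by move=> x; rewrite lee_fin mulr_ge0// pq2.1.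
  - by move=> j _; rewrite lee_fin mulr_ge0// pq1.1.
  - by move=> j _; rewrite mule_ge0// lee_fin mulr_ge0// pq2.1.
apply: EFin_inj; rewrite -E// -E//.
by apply: eq_esum => j _; rewrite H.
Qed.

Lemma prob_vec_idm (R : realType) (X : countType) (i : X) :
  prob_vec (@idm R X i).
Proof.
split; first by move=> j; rewrite /idm ler0n.
rewrite (@esumID R X [set i])//; last by move=> j _; rewrite lee_fin ler0n.
rewrite !setTI esum_set1 ?lee_fin ?ler0n// esum1 /idm ?eqxx ?adde0//.
by move=> j /= /eqP ji; rewrite eq_sym (negbTE ji).
Qed.

Lemma ev_idm (R : realType) (X : countType) (i : X) (g : X -> R) :
  (forall j, 0 <= g j) -> ev (@idm R X i) g = g i.
Proof.
move=> g0; rewrite /ev (@esumID R X [set i])//; last first.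
  by move=> j _; rewrite lee_fin mulr_ge0 ?ler0n.
rewrite !setTI esum_set1 ?lee_fin ?mulr_ge0 ?ler0n// esum1 /idm ?eqxx ?adde0 ?mul1r//.
by move=> j /= /eqP ji; rewrite eq_sym (negbTE ji) mul0r.
Qed.

Lemma ev_vmul (R : realType) (X : countType) (p : X -> R) (K : X -> X -> R)
    (g : X -> R) (C : R) :
  prob_vec p -> (forall i, prob_vec (K i)) -> (forall j, 0 <= g j <= C) ->
  ev (vmul p K) g = ev p (fun i => ev (K i) g).
Proof.
move=> pp pK gC.
have g0 j : 0 <= g j by case/andP: (gC j).
have K1 i j : 0 <= K i j <= 1.
  rewrite (pK i).1 /= -lee_fin -(pK i).2.
  rewrite (@esumID R X [set j])//; last by move=> x _; rewrite lee_fin (pK i).1.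
  rewrite setTI esum_set1 ?lee_fin ?(pK i).1//.
  by rewrite leeDl// esum_ge0// => x _; rewrite lee_fin (pK i).1.
have vE j : ((vmul p K j)%:E = \esum_(i in [set: X]) (p i * K i j)%:E)%E.
  by rewrite (@ev_fin _ _ p (K ^~ j) 1).
rewrite /ev; congr fine.
transitivity (\esum_(j in [set: X]) \esum_(i in [set: X])
    (p i * K i j * g j)%:E)%E.
  apply: eq_esum => j _; rewrite EFinM vE muleC -esumZl//.
    by apply: eq_esum => i _; rewrite -EFinM mulrC.
  by move=> i; rewrite lee_fin mulr_ge0 ?pp.1 ?(pK i).1.
have F i j : (0 <= (p i * K i j * g j)%:E)%E.
  by rewrite lee_fin !mulr_ge0 ?pp.1 ?(pK i).1.
transitivity (\esum_(i in [set: X]) \esum_(j in [set: X])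
    (p i * K i j * g j)%:E)%E.
  rewrite !esum_esum//.
  rewrite (@reindex_esum R _ _ (setT `*`` (fun=> setT)) _ (fun x => (x.2, x.1)))//.
  split => //.
    by move=> [a b] [c d] _ _ [] -> ->.
  by move=> [a b] _; exists (b, a).
apply: eq_esum => i _; rewrite EFinM -(ev_fin (pK i) gC) -esumZl ?pp.1//.
  by apply: eq_esum => j _; rewrite -EFinM mulrA.
by move=> j; rewrite lee_fin mulr_ge0 ?(pK i).1.
Qed.

(** * The reversed kernel and the kernels K_n *)

Lemma prob_vec_le1 (R : realType) (X : countType) (p : X -> R) (j : X) :
  prob_vec p -> p j <= 1.
Proof.
move=> pp; rewrite -lee_fin -pp.2.
rewrite (@esumID R X [set j])//; last by move=> x _; rewrite lee_fin pp.1.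
rewrite setTI esum_set1 ?lee_fin ?pp.1//.
by rewrite leeDl// esum_ge0// => x _; rewrite lee_fin pp.1.
Qed.

Section reversal.
Context (R : realType) (X : countType) (theta : R) (Q : X -> X -> R)
  (mu : X -> R) (M : nat).
Hypotheses (theta_gt0 : 0 < theta) (sQ : stochastic Q) (sm : stationary Q mu).

Local Notation Q' := (Qtp theta Q mu).

Let pQ i : prob_vec (Q i).
Proof. by case: sQ => Q0 Q1; split. Qed.

Let pmu : prob_vec mu. Proof. by case: sm. Qed.

Let muQ j : (\esum_(i in [set: X]) (mu i * Q i j)%:E = (mu j)%:E)%E.
Proof.
rewrite (@ev_fin _ _ mu (Q ^~ j) 1)//; last first.
  by move=> i; rewrite (pQ i).1 (prob_vec_le1 _ (pQ i)).
by congr EFin; move/(congr1 (@^~ j)): sm.2.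
Qed.

Lemma QtpE i j :
  Q' i j = if mu i != 0 then mu j * Q j i / mu i else (i == j)%:R.
Proof.
rewrite /Qtp /Gtp /Gt /idm; case: ifPn => mui; last by rewrite mul0r addr0.
have tn0 : theta != 0 by rewrite gt_eqF.
rewrite [j == i]eq_sym; case: (eqVneq i j) => [<-|ij] /=; rewrite ?mulr1n ?mulr0n;
  by field; rewrite ?tn0 ?mui ?andbT.
Qed.

(** If [mu j = 0], the terms [mu i * Q i j] are nonnegative and sum to [mu j = 0] by stationarity,
    so both sides vanish. *)
Lemma detailed_balance i j : mu i * Q i j = mu j * Q' j i.
Proof.
rewrite QtpE; case: ifPn => [muj|/negbNE/eqP muj].
  by rewrite mulrC [RHS]mulrC -mulrA mulVf// mulr1 mulrC.
rewrite muj mul0r; apply/eqP; rewrite eq_le mulr_ge0 ?pmu.1 ?(pQ i).1// andbT.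
rewrite -lee_fin -muj -muQ.
rewrite (@esumID R X [set i])//; last first.
  by move=> x _; rewrite lee_fin mulr_ge0 ?pmu.1 ?(pQ x).1.
rewrite setTI esum_set1 ?lee_fin ?mulr_ge0 ?pmu.1 ?(pQ i).1//.
rewrite leeDl// esum_ge0// => x _.
by rewrite lee_fin mulr_ge0 ?pmu.1 ?(pQ x).1.
Qed.

Lemma prob_vec_Qtp i : prob_vec (Q' i).
Proof.
have [mui|mui] := boolP (mu i != 0); last first.
  rewrite (_ : Q' i = @idm R X i); first exact: prob_vec_idm.
  by apply/funext => j; rewrite QtpE (negbTE mui).
split=> [j|].
  by rewrite QtpE mui mulr_ge0 ?invr_ge0 ?mulr_ge0 ?pmu.1 ?(pQ j).1.
under eq_esum do rewrite QtpE mui mulrC EFinM.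
rewrite esumZl ?invr_ge0 ?pmu.1//; last first.
  by move=> j; rewrite lee_fin mulr_ge0 ?pmu.1 ?(pQ j).1.
by rewrite muQ -EFinM mulVf.
Qed.

Hypothesis M_big : M_threshold (Gtp theta Q mu) < M%:R.

(** The subtraction-free form of [K_n = (1 - theta/n) I + (theta/n) Q']; the coefficient
    [1 - theta/n] is negative when [M < n < theta]. *)
Lemma Kn_add n i j : (M < n)%N ->
  Kn (Gtp theta Q mu) M n i j + theta / n%:R * idm R i j =
  idm R i j + theta / n%:R * Q' i j.
Proof.
move=> Mn; have n0 : (n%:R : R) != 0 by rewrite pnatr_eq0 -lt0n; case: n Mn.
have tn0 : theta != 0 by rewrite gt_eqF.
by rewrite /Kn Mn /Qtp; field; rewrite tn0 n0.
Qed.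

Let Gtp_le0 i : Gtp theta Q mu i i <= 0.
Proof.
have tn0 : theta != 0 by rewrite gt_eqF.
have := prob_vec_le1 i (prob_vec_Qtp i); rewrite /Qtp /idm eqxx.
by rewrite gerDl pmulr_lle0 ?invr_gt0.
Qed.

Lemma prob_vec_Kn n i : prob_vec (Kn (Gtp theta Q mu) M n i).
Proof.
have [Mn|Mn] := ltnP M n; last first.
  rewrite (_ : Kn _ _ _ _ = @idm R X i); first exact: prob_vec_idm.
  by apply/funext => j; rewrite /Kn ltnNge Mn addr0.
have n0 : (0 : R) < n%:R by rewrite ltr0n; case: n Mn.
have K0 j : 0 <= Kn (Gtp theta Q mu) M n i j.
  (* The threshold is an infimum, so some admissible [s] lies below [M]. Passing from [s] to the
     larger [n] keeps the signs off the diagonal and only shrinks the nonpositive diagonal entry of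
     [G'/s]. *)
  have [s [[s0 sG] sM]] : exists s : R, (0 < s /\ forall i j,
      0 <= idm R i j + Gtp theta Q mu i j / s) /\ s < M%:R.
    have [|s sS sM] := @inf_lt R _ M%:R _ M_big; last by exists s.
    by exists theta; split => // a b; exact: (prob_vec_Qtp a).1.
  have sn : s < n%:R by rewrite (lt_trans sM)// ltr_nat.
  have := sG i j; rewrite /Kn Mn /idm; case: eqVneq => [<-|ij].
    have := Gtp_le0 i; set G := Gtp _ _ _ _ _ => G0 H.
    apply: le_trans H _; rewrite lerD2l.
    by rewrite ler_wnM2l// lef_pV2 ?posrE// ltW.
  by rewrite !add0r !pmulr_lge0 ?invr_gt0.
split=> //.
have t0 : 0 <= theta / n%:R by rewrite divr_ge0 ?ler0n// ltW.
have E p1 p2 : (forall j, 0 <= p1 j) -> prob_vec p2 ->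
    (\esum_(j in [set: X]) (p1 j + theta / n%:R * p2 j)%:E =
     \esum_(j in [set: X]) (p1 j)%:E + (theta / n%:R)%:E)%E.
  move=> p10 pp2; under eq_esum do rewrite EFinD [(theta / _ * _)%:E]EFinM.
  rewrite esumD; last 2 first.
  - by move=> j _; rewrite lee_fin.
  - by move=> j _; rewrite mule_ge0 ?lee_fin// pp2.1.
  by rewrite esumZl ?pp2.2 ?mule1// => j; rewrite lee_fin pp2.1.
(* Summing [Kn_add] over a row, the finite mass [theta / n] appears on both sides and cancels. *)
have := E _ _ K0 (prob_vec_idm R i).
rewrite (eq_esum (b := fun j => (idm R i j + theta / n%:R * Q' i j)%:E)); last first.
  by move=> j _; rewrite Kn_add.
rewrite (E _ _ (prob_vec_idm R i).1 (prob_vec_Qtp i)) (prob_vec_idm R i).2.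
by move/(congr1 (fun x => x - (theta / n%:R)%:E)%E); rewrite !addeK.
Qed.

Lemma ev_Kn n i (g : X -> R) (C : R) : (M < n)%N -> (forall j, 0 <= g j <= C) ->
  ev (Kn (Gtp theta Q mu) M n i) g =
  (1 - theta / n%:R) * g i + theta / n%:R * ev (Q' i) g.
Proof.
move=> Mn gC; have t0 : 0 <= theta / n%:R by rewrite divr_ge0 ?ler0n// ltW.
have g0 j : 0 <= g j by case/andP: (gC j).
have := @ev_comb _ _ _ _ _ _ g _ C (prob_vec_Kn n i) (prob_vec_idm R i)
  (prob_vec_idm R i) (prob_vec_Qtp i) gC t0 (fun j => Kn_add i j Mn).
by rewrite ev_idm//; lra.
Qed.

Lemma ev_Kn_small n i (g : X -> R) : (n <= M)%N -> (forall j, 0 <= g j) ->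
  ev (Kn (Gtp theta Q mu) M n i) g = g i.
Proof.
move=> nM g0; rewrite (_ : Kn _ _ _ _ = @idm R X i) ?ev_idm//.
by apply/funext => j; rewrite /Kn ltnNge nM addr0.
Qed.

End reversal.

(** * Contraction of Lipschitz functions *)

Definition sdist (R : realType) (X : countType) (F : seq X) (v w : X -> R) : R :=
  \sum_(x <- F) `|v x - w x|.

(** Since [sdist F] vanishes on vectors that agree on the finite list [F], a function of this class
    sees only these coordinates of [v], which suits the coordinatewise topology. *)
Definition lipclass (R : realType) (X : countType) (F : seq X) (C L : R)
    (h : (X -> R) -> X -> R) : Prop :=
  (forall v i, 0 <= h v i <= C) /\
  (forall v w i, `|h v i - h w i| <= L * sdist F v w).

Definition push (R : realType) (X : countType) (n : nat) (v : X -> R) (j : X)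
    : X -> R :=
  fun l => (n%:R * v l + idm R j l) / n.+1%:R.

Definition step (R : realType) (X : countType) (K : X -> X -> R) (n : nat)
    (h : (X -> R) -> X -> R) : (X -> R) -> X -> R :=
  fun v i => ev (K i) (fun j => h (push n v j) j).

(** The product [P_n ... P_(n+m-1)] of transition operators, with the earliest one outermost. *)
Fixpoint steps (R : realType) (X : countType) (K : nat -> X -> X -> R)
    (n m : nat) (h : (X -> R) -> X -> R) : (X -> R) -> X -> R :=
  if m is m'.+1 then step (K n) n (steps K n.+1 m' h) else h.

Definition unit_box (R : realType) (X : countType) (v : X -> R) : Prop :=
  forall l, 0 <= v l <= 1.

Section seminorm.
Context (R : realType) (X : countType) (F : seq X).
Implicit Types v w : X -> R.

Lemma sdist_ge0 v w : 0 <= sdist F v w.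
Proof. by apply: sumr_ge0 => x _. Qed.

Lemma sdist_homo v w v' w' (a : R) : 0 <= a ->
  (forall l, `|v l - w l| <= a * `|v' l - w' l|) ->
  sdist F v w <= a * sdist F v' w'.
Proof. by move=> a0 H; rewrite /sdist mulr_sumr; apply: ler_sum. Qed.

Lemma sdist_le v w (a : R) : (forall l, `|v l - w l| <= a) ->
  sdist F v w <= a * (size F)%:R.
Proof.
move=> H; rewrite /sdist -sum1_size natr_sum mulr_sumr.
by apply: ler_sum => x _; rewrite mulr1.
Qed.

Lemma sdist_push n v w j :
  sdist F (push n v j) (push n w j) <= n%:R / n.+1%:R * sdist F v w.
Proof.
apply: sdist_homo => [|l]; first by rewrite divr_ge0.
rewrite /push -mulrBl opprD addrACA subrr addr0 -mulrBr.
by rewrite mulrAC !normrM normfV !normr_nat lexx.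
Qed.

Lemma unit_box_idm (i : X) : unit_box (idm R i).
Proof. by move=> l; rewrite /idm; case: eqP; rewrite ?ler01 ?lexx. Qed.

Lemma sdist_push_id n v j : unit_box v ->
  sdist F (push n v j) v <= n.+1%:R^-1 * (size F)%:R.
Proof.
move=> v01; apply: sdist_le => l.
rewrite (_ : push n v j l - v l = (idm R j l - v l) / n.+1%:R); last first.
  by rewrite /push -natr1; field; rewrite natr1 pnatr_eq0.
rewrite normrM normfV normr_nat ler_piMl ?invr_ge0//.
by have := v01 l; have := unit_box_idm j l; rewrite ler_norml; lra.
Qed.

End seminorm.

Section steps.
Context (R : realType) (X : countType) (F : seq X) (C : R).
Implicit Types h : (X -> R) -> X -> R.

Lemma lipclass_step (K : X -> X -> R) n h (L : R) : (forall i, prob_vec (K i)) ->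
  0 <= L -> lipclass F C L h ->
  lipclass F C (L * (n%:R / n.+1%:R)) (step K n h).
Proof.
move=> pK L0 [hC hL]; split => [v i|v w i]; first exact: ev_bound.
apply: (@ev_dist _ _ _ _ _ C) => // j; apply: le_trans (hL _ _ _) _.
by rewrite -mulrA ler_wpM2l// sdist_push.
Qed.

Lemma lipclassW h (L L' : R) : L <= L' -> lipclass F C L h -> lipclass F C L' h.
Proof.
move=> LL' [hC hL]; split=> // v w i.
by apply: le_trans (hL _ _ _) _; rewrite ler_wpM2r// sdist_ge0.
Qed.

Variable K : nat -> X -> X -> R.
Hypothesis pK : forall n i, prob_vec (K n i).

(** The contraction factors [k/(k+1)] telescope. *)
Lemma lipclass_steps n m h (L : R) : 0 <= L -> lipclass F C L h ->
  lipclass F C (L * (n.+1%:R / (n.+1 + m)%:R)) (steps K n.+1 m h).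
Proof.
move=> L0 hL; elim: m n => [|m IH] n /=.
  by rewrite addn0 divff ?mulr1// pnatr_eq0.
have -> : L * (n.+1%:R / (n.+1 + m.+1)%:R) =
    L * (n.+2%:R / (n.+2 + m)%:R) * (n.+1%:R / n.+2%:R) :> R.
  have H (a b y : R) : b != 0 -> y != 0 -> L * (a / y) = L * (b / y) * (a / b).
    by move=> b0 y0; field; rewrite b0 y0.
  by rewrite addnS -addSn; apply: H; rewrite pnatr_eq0.
apply: lipclass_step (IH n.+1) => //.
by rewrite mulr_ge0// divr_ge0.
Qed.

Lemma lipclass_steps0 n m h (L : R) : 0 <= L -> lipclass F C L h ->
  lipclass F C L (steps K n.+1 m h).
Proof.
move=> L0 /(@lipclass_steps n m) => /(_ L0); apply: lipclassW.
by rewrite ler_piMr// ler_pdivrMr ?ltr0n// mul1r ler_nat leq_addr.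
Qed.

(** An abstract form of the two laws: [Lf n] is the expectation over the occupation measure of the
    first [n] states together with the last of these states, and [lam] is the expectation under the
    limit law. *)
Variable Lf : nat -> ((X -> R) -> X -> R) -> R.
Variable lam : ((X -> R) -> X -> R) -> R.
Hypothesis chain : forall n h, (forall v i, 0 <= h v i <= C) ->
  Lf n.+2 h = Lf n.+1 (step (K n.+1) n.+1 h).
Variables (A L : R) (n0 : nat).
Hypotheses (A0 : 0 <= A) (L0 : 0 <= L).
Hypothesis almost_invariant : forall n h, (n0 <= n)%N -> lipclass F C L h ->
  `|lam h - lam (step (K n.+1) n.+1 h)| <= A / n.+1%:R ^+ 2.
Hypothesis Lf_dist : forall n h g (e : R), lipclass F C L h -> lipclass F C L g ->
  (forall v i, unit_box v -> `|h v i - g v i| <= e) ->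
  `|Lf n.+1 h - Lf n.+1 g| <= e.
Hypothesis lam_dist : forall h g (e : R), lipclass F C L h -> lipclass F C L g ->
  (forall v i, unit_box v -> `|h v i - g v i| <= e) -> `|lam h - lam g| <= e.
Hypothesis mixing : forall e : R, 0 < e -> exists n1, forall n, (n1 <= n)%N ->
  forall g : X -> R, (forall i, 0 <= g i <= C) ->
  `|Lf n (fun=> g) - lam (fun=> g)| <= e.

Lemma Lf_steps n m h : lipclass F C L h ->
  Lf (n.+1 + m) h = Lf n.+1 (steps K n.+1 m h).
Proof.
move=> hL; elim: m n => [|m IH] n /=; first by rewrite addn0.
rewrite addnS -addSn IH chain//; exact: (lipclass_steps0 _ _ L0 hL).1.
Qed.

(** Comparing [1/(n+1)^2] with [1/n - 1/(n+1)] makes the errors of successive steps telescope, so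
    the total stays below [A / n] whatever [m] is. *)
Lemma lam_steps n m h : (n0 <= n)%N -> (0 < n)%N -> lipclass F C L h ->
  `|lam h - lam (steps K n.+1 m h)| <= A * (n%:R^-1 - (n + m)%:R^-1).
Proof.
move=> n0n n_gt0 hL; elim: m n n0n n_gt0 => [|m IH] n n0n n_gt0 /=.
  by rewrite addn0 !subrr normr0 mulr0.
have := IH n.+1 (leqW n0n) isT; set g := steps _ _ _ _ => H1.
have H2 := almost_invariant n0n (lipclass_steps0 n.+1 m L0 hL).
have H3 : A / n.+1%:R ^+ 2 <= A * (n%:R^-1 - n.+1%:R^-1).
  rewrite ler_wpM2l//.
  have -> : n%:R^-1 - n.+1%:R^-1 = (n%:R * n.+1%:R)^-1 :> R.
    have H (a b : R) : a != 0 -> b != 0 -> b = a + 1 -> a^-1 - b^-1 = (a * b)^-1.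
      by move=> a0 b0 ab; rewrite ab in b0 *; field; rewrite a0 b0.
    by apply: H; rewrite ?pnatr_eq0 -?lt0n// natr1.
  rewrite lef_pV2 ?posrE ?exprn_gt0 ?mulr_gt0 ?ltr0n//.
  by rewrite expr2 ler_wpM2r// ler_nat.
rewrite addnS -addSn.
apply: (@le_trans _ _ (`|lam h - lam g| + `|lam g - lam (step (K n.+1) n.+1 g)|)).
  by rewrite (le_trans _ (ler_normD _ _))// addrA subrK.
apply: le_trans (lerD H1 (le_trans H2 H3)) _.
by rewrite -mulrDr addrC addrA subrK.
Qed.

Theorem Lf_cvg h : lipclass F C L h -> Lf n h @[n --> \oo] --> lam h.
Proof.
move=> hL; apply/cvgrPdist_le => e e0.
have e40 : 0 < e / 4 by rewrite divr_gt0.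
have [n1 n1P] := mixing e40.
pose D : R := (size F)%:R.
have D0 : 0 <= D by [].
have [n2 n2P] : exists n2, forall n, (n2 <= n)%N -> A * n.+1%:R^-1 <= e / 4.
  have := @cvg_harmonic R; move/cvgrPdist_le.
  have A10 : 0 < A + 1 by rewrite ltr_wpDl.
  move=> /(_ (e / 4 / (A + 1))); rewrite divr_gt0// => /(_ isT) [n2 _ H].
  exists n2 => n /H; rewrite sub0r normrN /harmonic /= ger0_norm ?invr_ge0//.
  rewrite ler_pdivlMr// => H'; apply: le_trans H'.
  by rewrite mulrC ler_wpM2l ?invr_ge0// lerDl.
(* The time [n] is fixed first, late enough for almost invariance, for mixing and for
   [A / n <= e / 4]. Only then is [m] taken large, to make the Lipschitz constant of [steps]
   small. *)
pose n := (maxn (maxn n0 n1) n2).+1.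
have [n3 n3P] : exists n3, forall m, (n3 <= m)%N ->
    L * (n.+1%:R / (n.+1 + m)%:R) * D <= e / 4.
  have := @cvg_harmonic R; move/cvgrPdist_le.
  pose B := L * D * n.+1%:R.
  have B0 : 0 <= B by rewrite !mulr_ge0.
  have B10 : 0 < B + 1 by rewrite ltr_wpDl.
  move=> /(_ (e / 4 / (B + 1))); rewrite divr_gt0// => /(_ isT) [n2' _ H].
  exists n2' => m /H; rewrite sub0r normrN /harmonic /= ger0_norm ?invr_ge0//.
  rewrite ler_pdivlMr// => H'; apply: le_trans H'.
  rewrite (_ : L * _ * D = B / (n.+1 + m)%:R); last by rewrite /B; ring.
  rewrite [X in _ <= X]mulrC; apply: (@le_trans _ _ (B / m.+1%:R)).
    by rewrite ler_wpM2l// lef_pV2 ?posrE ?ltr0n// ler_nat addSn ltnS leq_addl.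
  by rewrite ler_wpM2r ?invr_ge0// lerDl.
exists (n.+1 + n3)%N => // N /= HN.
have [m -> n3m] : exists2 m, N = (n.+1 + m)%N & (n3 <= m)%N.
  exists (N - n.+1)%N; first by rewrite subnKC// (leq_trans _ HN)// leq_addr.
  by rewrite leq_subRL// (leq_trans _ HN)// leq_addr.
rewrite Lf_steps//; set g := steps _ _ _ _.
have gL := lipclass_steps n m L0 hL; have gL0 := lipclass_steps0 n m L0 hL.
have H0 : `|lam h - lam g| <= e / 4.
  apply: le_trans (@lam_steps n m h _ _ hL) _ => //.
    by rewrite /n leqW// !leq_max leqnn.
  apply: (@le_trans _ _ (A * n%:R^-1)); last by apply: n2P; rewrite !leq_max leqnn orbT.
  by rewrite ler_wpM2l// gerBl invr_ge0.
(* Freezing the first argument at 0 costs at most the Lipschitz constant times [size F] on the unit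
   box, and leaves a function of the state alone, to which [mixing] applies. *)
pose z : X -> R := fun=> 0.
pose c : (X -> R) -> X -> R := fun _ i => g z i.
have cL : lipclass F C L c.
  split=> [v i|v w i]; first exact: gL.1.
  by rewrite /c subrr normr0 mulr_ge0// sdist_ge0.
have gc v i : unit_box v -> `|g v i - c v i| <= e / 4.
  move=> v01; apply: le_trans (gL.2 _ _ _) _; apply: le_trans (n3P m n3m).
  rewrite ler_wpM2l ?mulr_ge0 ?divr_ge0//.
  rewrite -[X in _ <= X]mul1r; apply: sdist_le => l; rewrite subr0.
  by have := v01 l; rewrite ler_norml; lra.
have H1 := Lf_dist n gL0 cL gc; have H2 := lam_dist gL0 cL gc.
have H3 : `|Lf n.+1 c - lam c| <= e / 4.
  apply: n1P => [|i]; last exact: gL.1.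
  by rewrite /n !leqW// !leq_max leqnn orbT.
move: H0 H1 H2 H3; rewrite !ler_norml; lra.
Qed.

End steps.

(** * Powers of the ratio [(n+1)/(n+2)] *)

(** The power is the probability that a Beta(1,theta) stick exceeds [1/(n+2)], and it agrees with
    the coefficient [1 - theta/(n+1)] of the kernel up to second order. Both bounds follow from
    [ln (1 + x) <= x] and [1 + x <= exp x]. *)
Lemma powR_ratio_bounds (R : realType) (theta : R) (n : nat) : 0 < theta ->
  1 - theta / n.+1%:R <= powR (n.+1%:R / n.+2%:R) theta
    <= 1 - theta / n.+1%:R + theta * (1 + theta) / n.+1%:R ^+ 2.
Proof.
move=> t0; set a : R := n.+1%:R; have a0 : 0 < a by rewrite ltr0n.
have -> : n.+2%:R = a + 1 by rewrite /a -natr1.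
clearbody a.
have a10 : 0 < a + 1 by rewrite ltr_wpDl// ltW.
have r0 : 0 < a / (a + 1) by rewrite divr_gt0.
rewrite /powR gt_eqF//; apply/andP; split.
  apply: le_trans (expR_ge1Dx _).
  rewrite lerD2l -mulrN; apply: ler_wpM2l; first exact: ltW.
  have -> : ln (a / (a + 1)) = - ln ((a + 1) / a).
    by rewrite -lnV ?posrE ?divr_gt0// invf_div.
  rewrite lerN2.
  rewrite (_ : (a + 1) / a = 1 + a^-1); last by field; rewrite gt_eqF.
  by apply: le_ln1Dx; rewrite (lt_trans (ltrN10 R))// invr_gt0.
have H : ln (a / (a + 1)) <= - (a + 1)^-1.
  rewrite (_ : a / (a + 1) = 1 + - (a + 1)^-1); last by field; rewrite gt_eqF.
  by apply: le_ln1Dx; rewrite ltrN2 invf_lt1// ltrDr.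
apply: (@le_trans _ _ (expR (- (theta / (a + 1))))).
  by rewrite ler_expR -mulrN; apply: ler_wpM2l => //; exact: ltW.
rewrite expRN; apply: (@le_trans _ _ (1 + theta / (a + 1))^-1).
  by rewrite lef_pV2 ?posrE ?expR_gt0 ?expR_ge1Dx// ltr_pwDl// divr_ge0// ltW.
have at0 : 0 < a + 1 + theta by rewrite addr_gt0.
have -> : (1 + theta / (a + 1))^-1 = 1 - theta / (a + 1 + theta).
  by field; rewrite ?(gt_eqF a10) ?(gt_eqF at0) ?(gt_eqF a0).
have -> : 1 - theta / (a + 1 + theta)
   = 1 - theta / a + theta * (1 + theta) / (a * (a + 1 + theta)).
  by field; rewrite ?(gt_eqF a10) ?(gt_eqF at0) ?(gt_eqF a0).
rewrite lerD2l; apply: ler_wpM2l; first by rewrite mulr_ge0 ?addr_ge0// ltW.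
rewrite lef_pV2 ?posrE ?mulr_gt0 ?exprn_gt0// expr2.
apply: ler_wpM2l; first exact: ltW.
by rewrite ltW// -addrA ltrDl addr_gt0.
Qed.

(** This plays the part of the divergence of [sum theta/k]: the power dominates the product of the
    factors [1 - theta/k] from time [N] on. *)
Lemma powR_ratio_small (R : realType) (theta e : R) (N : nat) :
  0 < theta -> 0 < e ->
  exists j0, forall j, (j0 <= j)%N ->
    powR (N.+1%:R / (N + j).+1%:R) theta <= e.
Proof.
move=> t0 e0; set d := powR e theta^-1.
have d0 : 0 < d by rewrite powR_gt0.
have := @cvg_harmonic R; move/cvgrPdist_le.
move=> /(_ (d / N.+1%:R)); rewrite divr_gt0 ?ltr0n// => /(_ isT) [j0 _ H].
exists j0 => j /H; rewrite sub0r normrN /harmonic /= ger0_norm ?invr_ge0//.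
rewrite ler_pdivlMr ?ltr0n// => H'.
have -> : e = powR d theta.
  by rewrite /d -powRrM mulVf ?gt_eqF// powRr1// ltW.
apply: ge0_ler_powR; [exact: ltW|by rewrite nnegrE divr_ge0|by rewrite nnegrE ltW|].
apply: le_trans H'; rewrite mulrC ler_wpM2r//.
by rewrite lef_pV2 ?posrE ?ltr0n// ler_nat ltnS leq_addl.
Qed.

(** * Trajectories of Markov chains *)

Lemma Rintegral_kernel d1 (T1 : measurableType d1) d2 (T2 : measurableType d2)
    (R : realType) (P1 : probability T1 R) (P2 : probability T2 R)
    (A B : countType) (U1 : T1 -> A) (V1 : T1 -> B) (U2 : T2 -> A)
    (k : A -> B -> R) (g : A -> B -> R) (C : R) :
  (forall a, measurable (U1 @^-1` [set a])) ->
  (forall b, measurable (V1 @^-1` [set b])) ->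
  (forall a, measurable (U2 @^-1` [set a])) ->
  (forall a, prob_vec (k a)) -> (forall a b, 0 <= g a b <= C) ->
  (forall a b, P1 (U1 @^-1` [set a] `&` V1 @^-1` [set b]) =
     (P2 (U2 @^-1` [set a]) * (k a b)%:E)%E) ->
  \int[P1]_w g (U1 w) (V1 w) = \int[P2]_w ev (k (U2 w)) (g (U2 w)).
Proof.
move=> mU1 mV1 mU2 pk gC H; rewrite /Rintegral; congr fine.
rewrite (@integral_kernel _ _ _ _ _ P1 P2 _ _ U1 V1 U2 k
  (fun a b => (g a b)%:E))//.
- apply: eq_integral => w _; rewrite -(ev_fin (pk _) (gC (U2 w))).
  by apply: eq_esum => b _; rewrite EFinM.
- by move=> a b; exact: (pk a).1.
- by move=> a b; rewrite lee_fin; case/andP: (gC a b).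
Qed.

Lemma Rintegral_countable d (T : measurableType d) (R : realType)
    (P : probability T R) (Y : countType) (U : T -> Y) (p g : Y -> R) (C : R) :
  (forall y, measurable (U @^-1` [set y])) ->
  (forall y, P (U @^-1` [set y]) = (p y)%:E) ->
  (forall y, 0 <= g y <= C) -> \int[P]_w g (U w) = ev p g.
Proof.
move=> mU Up gC; rewrite /Rintegral /ev; congr fine.
rewrite (@integral_countable _ _ _ P setT Y U (fun y => (g y)%:E))//; last first.
  by move=> y; rewrite lee_fin; case/andP: (gC y).
by apply: eq_esum => y _; rewrite setTI [X in (_ * X)%E]Up EFinM muleC.
Qed.

Lemma Rintegral_dist d (T : measurableType d) (R : realType)
    (P : probability T R) (f g : T -> R) (C e : R) :
  measurable_fun setT f -> measurable_fun setT g ->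
  (forall w, 0 <= f w <= C) -> (forall w, 0 <= g w <= C) ->
  (forall w, `|f w - g w| <= e) -> `|\int[P]_w f w - \int[P]_w g w| <= e.
Proof.
move=> mf mg fC gC fg.
have B (h : T -> R) : (forall w, 0 <= h w <= C) -> forall w, `|h w| <= C.
  by move=> hC w; have := hC w => /andP[h0 h1]; rewrite ger0_norm.
have If := bounded_Rintegrable P measurableT mf (B _ fC).
have Ig := bounded_Rintegrable P measurableT mg (B _ gC).
rewrite -RintegralB//.
have mfg : measurable_fun setT (fun w => f w - g w) by exact: measurable_funB.
have Ifg := bounded_Rintegrable P measurableT mfg fg.
apply: le_trans (le_normr_Rintegral _ Ifg) _ => //.
have -> : e = \int[P]_(w in setT) (cst e w).
  by rewrite /= Rintegral_cst// [X in fine X](_ : _ = 1%E) ?mulr1//; exact: probability_setT.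
apply: le_Rintegral => //.
- apply: (@bounded_Rintegrable _ _ _ _ _ (fun w => `|f w - g w|) e) => //.
    by apply: measurableT_comp.
  by move=> w; rewrite normr_id.
- exact: (@bounded_Rintegrable _ _ _ _ _ (cst e) `|e|).
Qed.

Lemma Rintegral_bound d (T : measurableType d) (R : realType)
    (P : probability T R) (f : T -> R) (C : R) :
  measurable_fun setT f -> (forall w, 0 <= f w <= C) ->
  0 <= \int[P]_w f w <= C.
Proof.
move=> mf fC; apply/andP; split.
  by apply: Rintegral_ge0 => w _; case/andP: (fC w).
have -> : C = \int[P]_(w in setT) (cst C w).
  by rewrite /= Rintegral_cst// [X in fine X](_ : _ = 1%E) ?mulr1//; exact: probability_setT.
apply: le_Rintegral => //.
- apply: (@bounded_Rintegrable _ _ _ _ _ _ C) => // w.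
  by case/andP: (fC w) => f0 f1; rewrite ger0_norm.
- exact: (@bounded_Rintegrable _ _ _ _ _ (cst C) `|C|).
- by move=> w _; case/andP: (fC w).
Qed.

Section path.
Context (X : countType) (x0 : X) d (Omega : measurableType d)
  (T : nat -> Omega -> X).
Hypothesis mT : forall k x, measurable (T k @^-1` [set x]).

(** Finite sequences over a countable type form a countable type, so a whole path is a single
    variable with countably many values. *)
Definition traj (n : nat) (w : Omega) : seq X := mkseq (fun k => T k w) n.

Lemma traj_preimageE n (s : seq X) :
  traj n @^-1` [set s] = if size s == n
    then [set w | forall k, (k < n)%N -> T k w = nth x0 s k] else set0.
Proof.
apply/seteqP; split=> [w /= <-|w].
  by rewrite size_mkseq eqxx => k kn; rewrite nth_mkseq.
case: ifPn => //= /eqP sn H; apply: (@eq_from_nth _ x0).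
  by rewrite size_mkseq sn.
by move=> k; rewrite size_mkseq => kn; rewrite nth_mkseq// H.
Qed.

Lemma measurable_traj n s : measurable (traj n @^-1` [set s]).
Proof.
rewrite traj_preimageE; case: ifPn => // _.
rewrite (_ : [set _ | _] =
    \bigcap_(k in [set k | (k < n)%N]) (T k @^-1` [set nth x0 s k])).
  by apply: bigcap_measurableType => // k _; exact: mT.
by apply/seteqP; split => [w H k kn|w H k kn]; apply: H.
Qed.

End path.

Section chain.
Context (R : realType) (X : countType) (x0 : X) d (Omega : measurableType d)
  (P : probability Omega R) (p : X -> R) (K : nat -> X -> X -> R)
  (T : nat -> Omega -> X).
Hypothesis mc : markov_chain P p K T.

Let mT : forall k x, measurable (T k @^-1` [set x]). Proof. by case: mc. Qed.

Lemma traj_law n s : size s = n.+1 -> P (traj T n.+1 @^-1` [set s]) =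
  (p (nth x0 s 0) * \prod_(k < n) K k (nth x0 s k) (nth x0 s k.+1))%:E.
Proof. by move=> sn; rewrite (traj_preimageE x0) sn eqxx -mc.2. Qed.

Lemma init_law x : P (T 0%N @^-1` [set x]) = (p x)%:E.
Proof.
have := mc.2 0%N (fun=> x); rewrite big_ord0 mulr1 => <-; congr (P _).
by apply/seteqP; split => [w /= H k|w /= H]; [rewrite leqn0 => /eqP ->|exact: H].
Qed.

Lemma traj_next n s j :
  P (traj T n.+1 @^-1` [set s] `&` T n.+1 @^-1` [set j]) =
  (P (traj T n.+1 @^-1` [set s]) * (K n (last x0 s) j)%:E)%E.
Proof.
have [sn|sn] := eqVneq (size s) n.+1; last first.
  by rewrite (traj_preimageE x0) (negbTE sn) set0I measure0 mul0e.
have -> : traj T n.+1 @^-1` [set s] `&` T n.+1 @^-1` [set j] =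
    traj T n.+2 @^-1` [set rcons s j].
  rewrite !(traj_preimageE x0) size_rcons sn !eqxx.
  apply/seteqP; split => [w [/= H1 H2] k|w /= H].
    rewrite ltnS leq_eqVlt => /predU1P[->|kn]; rewrite nth_rcons sn.
      by rewrite ltnn eqxx.
    by rewrite kn H1.
  split; last by rewrite H// nth_rcons sn ltnn eqxx.
  by move=> k kn; rewrite (H k (leqW kn)) nth_rcons sn kn.
rewrite !traj_law ?size_rcons ?sn// big_ord_recr /= -EFinM mulrA.
congr EFin; congr (_ * _); last first.
  rewrite !nth_rcons sn ltnSn ltnn eqxx; congr (K _ _ _).
  by rewrite -nth_last sn.
rewrite nth_rcons sn /=; congr (_ * _); apply: eq_bigr => k _.
by rewrite !nth_rcons sn !ltnS (ltnW (ltn_ord k)) ltn_ord.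
Qed.

Hypothesis pK : forall n i, prob_vec (K n i).

Lemma Rintegral_traj_next n (g : seq X -> X -> R) (C : R) :
  (forall s j, 0 <= g s j <= C) ->
  \int[P]_w g (traj T n.+1 w) (T n.+1 w) =
  \int[P]_w ev (K n (last x0 (traj T n.+1 w))) (g (traj T n.+1 w)).
Proof.
move=> gC.
apply: (@Rintegral_kernel _ _ _ _ _ P P _ _ (traj T n.+1) (T n.+1)
  (traj T n.+1) (fun s => K n (last x0 s)) g C) => //.
- exact: (measurable_traj x0).
- exact: (measurable_traj x0).
- exact: traj_next.
Qed.

End chain.

(** * Convergence in total variation and occupation measures *)

Lemma ev_seq (R : realType) (X : countType) (p g : X -> R) (F : seq X) :
  uniq F -> (forall j, 0 <= p j) -> (forall j, 0 <= g j) ->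
  ev p (fun j => g j * (j \in F)%:R) = \sum_(x <- F) p x * g x.
Proof.
move=> uF p0 g0; rewrite /ev.
rewrite (_ : esum _ _ = (\esum_(j in [set` F]) (p j * g j)%:E)%E).
  rewrite esum_fset; [|exact: finite_seq|by move=> i _; rewrite lee_fin mulr_ge0].
  by rewrite -fsbig_seq// sumEFin.
rewrite [RHS]esum_mkcond; apply: eq_esum => j _; rewrite mem_setE.
by case: ifPn => _; rewrite ?mulr1// !mulr0.
Qed.

Lemma prob_vec_tail (R : realType) (X : countType) (p : X -> R) (e : R) :
  prob_vec p -> 0 < e -> exists2 F : seq X, uniq F &
    1 - e <= \sum_(x <- F) p x.
Proof.
move=> pp e0; have H : (1 - e%:E < \esum_(i in [set: X]) (p i)%:E)%E.
  by rewrite pp.2 -EFinB lte_fin gtrBl.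
have [_ [A [finA _] <-]] := ereal_sup_gt H.
rewrite fsbig_finite// sumEFin -EFinB lte_fin => /ltW H'.
by exists (finmap.enum_fset (fset_set A)) => //; exact: finmap.fset_uniq.
Qed.

(* Scheffe's lemma, in the dual form of convergence in total variation. *)
Lemma ev_cvg_uniform (R : realType) (X : countType) (q : nat -> X -> R)
    (p : X -> R) (C e : R) :
  (forall m, prob_vec (q m)) -> prob_vec p ->
  (forall i, q m i @[m --> \oo] --> p i) -> 0 <= C -> 0 < e ->
  exists m0, forall m, (m0 <= m)%N -> forall g : X -> R,
    (forall i, 0 <= g i <= C) -> `|ev (q m) g - ev p g| <= e.
Proof.
move=> pq pp qp C0 e0.
(* On [F] the two averages differ by at most [C * e']; off [F] they are at most [C * e'] for [p] and
   [2 * C * e'] for [q m]. The [+ 1] covers [C = 0]. *)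
pose e' := e / (4 * (C + 1)).
have C10 : 0 < C + 1 by rewrite ltr_wpDl.
have e'0 : 0 < e' by rewrite divr_gt0// mulr_gt0.
have [F uF HF] := prob_vec_tail pp e'0.
have : \sum_(x <- F) `|q m x - p x| @[m --> \oo] --> \sum_(x <- F) `|p x - p x|.
  elim: (F) => [|x F' IH].
    by under eq_fun do rewrite big_nil; rewrite big_nil; exact: cvg_cst.
  under eq_fun do rewrite big_cons; rewrite big_cons; apply: cvgD IH.
  by apply: cvg_norm; apply: cvgB (qp x) _; exact: cvg_cst.
rewrite [X in _ --> X]big1; last by move=> x _; rewrite subrr normr0.
move/cvgrPdist_le => /(_ e' e'0) [m0 _ H]; exists m0 => m /H.
rewrite /= sub0r normrN ger0_norm ?sumr_ge0// => Hm g gC.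
have g0 j : 0 <= g j by case/andP: (gC j).
pose g1 j := g j * (j \in F)%:R; pose g2 j := g j * (j \notin F)%:R.
have g1C j : 0 <= g1 j <= C.
  by rewrite /g1; case: (j \in F); rewrite ?mulr1// mulr0 lexx.
have g2C j : 0 <= g2 j <= C.
  by rewrite /g2; case: (j \in F); rewrite ?mulr1// mulr0 lexx.
have split1 r : prob_vec r -> ev r g = \sum_(x <- F) r x * g x + ev r g2.
  move=> pr; rewrite -(ev_seq uF pr.1 g0) -(evD pr g1C g2C); congr ev.
  by apply/funext => j; rewrite /g1 /g2; case: (j \in F); rewrite mulr1 mulr0 ?addr0 ?add0r.
pose o (j : X) : R := (j \notin F)%:R.
have o01 j : 0 <= o j <= 1 by rewrite /o; case: (j \in F); rewrite ?ler01 ?lexx.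
have tail r : prob_vec r -> ev r o = 1 - \sum_(x <- F) r x.
  move=> pr; have := evD pr (g := fun j => 1 * (j \in F)%:R) _ o01.
  rewrite (ev_seq uF pr.1 (fun=> ler01)).
  under eq_bigr do rewrite mulr1.
  rewrite (_ : (fun j => _) = fun=> 1) ?ev_cst//; last first.
    by apply/funext => j; rewrite /o mul1r; case: (j \in F); rewrite ?addr0 ?add0r.
  move=> ->; first by rewrite addrC addKr.
  by move=> j; case: (j \in F); rewrite mul1r ?ler01 ?lexx.
have tail2 r : prob_vec r -> 0 <= ev r g2 <= C * (1 - \sum_(x <- F) r x).
  move=> pr; have := ev_bound pr g2C => /andP[-> _] /=.
  rewrite -tail// -(evZ pr o01 C0).
  rewrite -[X in _ <= X]addr0; apply: (@ev_le _ _ _ _ _ C) => // j.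
    by rewrite /o; case: (j \in F); rewrite ?mulr1 ?mulr0 ?C0 ?lexx.
  rewrite addr0 /g2 /o; case: (j \in F); rewrite ?mulr0// !mulr1.
  by case/andP: (gC j).
have Hd : `|\sum_(x <- F) q m x * g x - \sum_(x <- F) p x * g x| <= C * e'.
  rewrite -sumrB; apply: le_trans (ler_norm_sum _ _ _) _.
  apply: (@le_trans _ _ (C * \sum_(x <- F) `|q m x - p x|)).
    rewrite mulr_sumr; apply: ler_sum => x _.
    rewrite -mulrBl normrM [X in _ <= X]mulrC ler_wpM2l// ger0_norm//.
    by case/andP: (gC x).
  by rewrite ler_wpM2l.
have Hs : \sum_(x <- F) p x - \sum_(x <- F) q m x <= e'.
  rewrite -sumrB; apply: le_trans Hm; apply: ler_sum => x _.
  by rewrite distrC; exact: ler_norm.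
have T1 : C * (1 - \sum_(x <- F) p x) <= C * e' by apply: ler_wpM2l => //; lra.
have T2 : C * (1 - \sum_(x <- F) q m x) <= C * (e' + e').
  by apply: ler_wpM2l => //; lra.
have Ce : C * e' <= e / 4.
  rewrite (_ : C * e' = e / 4 * (C / (C + 1))); last first.
    by rewrite /e'; field; rewrite gt_eqF.
  apply: ler_piMr; first by rewrite divr_ge0// ltW.
  by rewrite ler_pdivrMr// mul1r lerDl.
have := tail2 _ pp; have := tail2 _ (pq m).
rewrite (split1 _ pp) (split1 _ (pq m)); move: Hd; rewrite !ler_norml; lra.
Qed.

Section occupation.
Context (R : realType) (X : countType) (x0 : X) d (Omega : measurableType d)
  (T : nat -> Omega -> X).

Definition occs (s : seq X) : X -> R :=
  fun l => (size s)%:R^-1 * \sum_(x <- s) (x == l)%:R.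

Lemma occupation_traj n w : occupation R T n w = occs (traj T n w).
Proof.
apply/funext => l; rewrite /occupation /occs size_mkseq; congr (_ * _).
rewrite big_map -(big_mkord xpredT (fun k => (T k w == l)%:R)).
by rewrite /index_iota subn0.
Qed.

Lemma last_traj n w : last x0 (traj T n.+1 w) = T n w.
Proof. by rewrite -nth_last size_mkseq nth_mkseq. Qed.

Lemma traj_rcons n w : traj T n.+1 w = rcons (traj T n w) (T n w).
Proof. by rewrite /traj -mkseqS. Qed.

Lemma occs_rcons s j : (0 < size s)%N ->
  occs (rcons s j) = push (size s) (occs s) j.
Proof.
move=> s0; apply/funext => l; rewrite /occs /push size_rcons -cats1 big_cat.
rewrite big_seq1 /idm mulrC; congr (_ / _); congr (_ + _).
by rewrite mulVKf// pnatr_eq0 -lt0n.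
Qed.

Lemma unit_box_occs s : unit_box (occs s).
Proof.
move=> l; rewrite /occs mulr_ge0 ?invr_ge0 ?sumr_ge0//=.
case: s => [|x s]; first by rewrite big_nil mulr0.
rewrite mulrC ler_pdivrMr ?ltr0n// mul1r -sum1_size natr_sum.
by apply: ler_sum => y _; case: (y == l).
Qed.

End occupation.

Lemma prob_vec_vmul (R : realType) (X : countType) (p : X -> R)
    (K : X -> X -> R) :
  prob_vec p -> (forall i, prob_vec (K i)) -> prob_vec (vmul p K).
Proof.
move=> pp pK; split.
  by move=> j; apply: (ev_ge0 pp (g := K ^~ j)) => i; exact: (pK i).1.
have := @ev_vmul _ _ p K (fun=> 1) 1 pp pK; rewrite /ev.
under [X in fine X]eq_esum do rewrite mulr1.
move=> H.
have : fine (\esum_(j in [set: X]) (vmul p K j)%:E)%E = 1.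
  rewrite H => [|j]; last by rewrite ler01 lexx.
  rewrite -[RHS](ev_cst pp ler01) /ev; congr fine; apply: eq_esum => i _.
  by congr (_ * _)%:E; rewrite -[LHS]/(ev (K i) (fun=> 1)) ev_cst.
case: (esum _ _) => [r /= ->//| /= |/=].
- by move/eqP; rewrite eq_sym oner_eq0.
- by move/eqP; rewrite eq_sym oner_eq0.
Qed.

(** * Mixing of the time-inhomogeneous chain *)

Section inhomogeneous_chain.
Context (R : realType) (X : countType) (x0 : X) (theta : R) (Q : X -> X -> R)
  (mu : X -> R) (M : nat) d (Omega : measurableType d) (P : probability Omega R)
  (pi : X -> R) (T : nat -> Omega -> X).
Hypotheses (theta_gt0 : 0 < theta) (sQ : stochastic Q) (sm : stationary Q mu).
Hypothesis M_big : M_threshold (Gtp theta Q mu) < M%:R.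
Hypothesis ppi : prob_vec pi.
Hypothesis pi_cvg : forall l, (fun n => vpow pi (Qtp theta Q mu) n l) @ \oo --> mu l.
Local Notation K := (Kn (Gtp theta Q mu) M).
Hypothesis mc : markov_chain P pi (fun k => K k.+1) T.

Let mT : forall k x, measurable (T k @^-1` [set x]). Proof. by case: mc. Qed.

Let pK n i : prob_vec (K n i).
Proof. exact: prob_vec_Kn. Qed.

Let p n (g : X -> R) := \int[P]_w g (T n w).

Let p_next n g (C : R) : (forall i, 0 <= g i <= C) ->
  p n.+1 g = p n (fun i => ev (K n.+1 i) g).
Proof.
move=> gC; have := @Rintegral_traj_next R X x0 _ _ P pi _ T mc
  (fun n i => pK n.+1 i) n (fun _ j => g j) C (fun _ j => gC j).
by rewrite /p => ->; apply: eq_Rintegral => w _; rewrite last_traj.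
Qed.

Let p_int n g (C : R) : (forall i, 0 <= g i <= C) ->
  P.-integrable setT (EFin \o (fun w => g (T n w))).
Proof.
move=> gC; apply: (@bounded_Rintegrable _ _ _ _ _ _ C) => //.
  exact: measurable_fun_countable.
by move=> w; case/andP: (gC (T n w)) => h0 h1; rewrite ger0_norm.
Qed.

Let p_lin n g h (C a b : R) : (forall i, 0 <= g i <= C) ->
  (forall i, 0 <= h i <= C) ->
  p n (fun i => a * g i + b * h i) = a * p n g + b * p n h.
Proof.
move=> gC hC; have Ig := p_int n gC; have Ih := p_int n hC.
rewrite /p RintegralD// ?RintegralZl//.
- have := @integrableZl _ _ _ P setT measurableT a _ Ig.
  by apply: eq_integrable => // w _; rewrite /= EFinM.
- have := @integrableZl _ _ _ P setT measurableT b _ Ih.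
  by apply: eq_integrable => // w _; rewrite /= EFinM.
Qed.

Let A (g : X -> R) : X -> R := fun i => ev (Qtp theta Q mu i) g.

Let A_bound g (C : R) m : (forall i, 0 <= g i <= C) ->
  forall i, 0 <= iter m A g i <= C.
Proof.
move=> gC; elim: m => [//|m IH] i /=; apply: ev_bound => //.
exact: prob_vec_Qtp.
Qed.

Let pv_vpow q m : prob_vec q -> prob_vec (vpow q (Qtp theta Q mu) m).
Proof.
by move=> pq; elim: m => [//|m IH]; apply: prob_vec_vmul => // i; exact: prob_vec_Qtp.
Qed.

Let ev_A g (C : R) m (q : X -> R) : (forall i, 0 <= g i <= C) -> prob_vec q ->
  ev q (iter m A g) = ev (vpow q (Qtp theta Q mu) m) g.
Proof.
move=> gC pq; elim: m g gC => [//|m IH] g gC.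
rewrite iterSr (IH (A g)) => [|i]; last exact: (A_bound 1 gC).
rewrite -(ev_vmul (C := C) (pv_vpow m pq))// => i; exact: prob_vec_Qtp.
Qed.

(** The index [m] counts extra steps of [Q'] made after time [n]; at [m = 0] this is closeness of
    the law of [T_n] to [mu] in total variation. *)
Let close n m (C e : R) := forall g : X -> R, (forall i, 0 <= g i <= C) ->
  `|p n (iter m A g) - ev mu g| <= e.

Let pmu : prob_vec mu. Proof. by case: sm. Qed.

(** With [a = theta/(n+1)], [E u(T_(n+1)) = (1 - a) E u(T_n) + a E (Q' u)(T_n)], so level [m] at the
    next time is governed by levels [m] and [m + 1] now. The absolute value accounts for times at
    which [a > 1]. *)
Let close_step n m (C e1 e2 : R) : (M <= n)%N ->
  close n m C e1 -> close n m.+1 C e2 ->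
  close n.+1 m C (`|1 - theta / n.+1%:R| * e1 + theta / n.+1%:R * e2).
Proof.
move=> Mn H1 H2 g gC; have AC := A_bound m gC; have AC' := A_bound m.+1 gC.
set a := theta / _; have a0 : 0 <= a by rewrite divr_ge0// ltW.
rewrite (p_next _ AC).
have -> : (fun i => ev (K n.+1 i) (iter m A g)) =
    (fun i => (1 - a) * iter m A g i + a * iter m.+1 A g i).
  by apply/funext => i; rewrite (@ev_Kn _ _ _ _ _ _ theta_gt0 sQ sm M_big _ _ _ C).
rewrite (p_lin _ _ _ AC AC'); clearbody a.
have := H1 g gC; have := H2 g gC.
move: (p n (iter m A g)) (p n (iter m.+1 A g)) (ev mu g) => u v z {}H2 {}H1.
have -> : (1 - a) * u + a * v - z = (1 - a) * (u - z) + a * (v - z) by ring.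
apply: le_trans (ler_normD _ _) _; rewrite !normrM (ger0_norm a0).
by rewrite lerD// ler_wpM2l.
Qed.

Let closeW n m (C e e' : R) : e <= e' -> close n m C e -> close n m C e'.
Proof. by move=> ee' H g gC; apply: le_trans (H g gC) ee'. Qed.

(** At time 0 this is the assumption on [pi], strengthened from entrywise convergence to total
    variation. One more time step costs a constant factor, absorbed by asking for a smaller error
    earlier; hence [m0] depends on [n]. *)
Let close_init n (C e : R) : 0 <= C -> 0 < e ->
  exists m0, forall m, (m0 <= m)%N -> close n m C e.
Proof.
move=> C0; elim: n e => [|n IH] e e0.
  have [m0 H] := ev_cvg_uniform (fun m => pv_vpow m ppi) pmu pi_cvg C0 e0.
  exists m0 => m /H {}H g gC; rewrite /p.
  have AC := A_bound m gC.
  rewrite (@Rintegral_countable _ _ _ P _ (T 0%N) pi (iter m A g) C)//.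
    by rewrite (ev_A _ gC ppi); exact: H.
  by move=> y; exact: (init_law mc).
have [Mn|Mn] := leqP n.+1 M.
  have [m0 H] := IH _ e0; exists m0 => m /H {}H g gC.
  have AC := A_bound m gC.
  rewrite (p_next _ AC) (_ : (fun i => _) = iter m A g); first exact: H.
  apply/funext => i; rewrite ev_Kn_small// => j.
  by case/andP: (AC j).
pose a := theta / n.+1%:R.
have a0 : 0 <= a by rewrite divr_ge0// ltW.
have b0 : 0 < `|1 - a| + a + 1 by rewrite ltr_wpDl// addr_ge0.
have f0 : 0 < e / (`|1 - a| + a + 1) by rewrite divr_gt0.
have [m0 H] := IH _ f0.
exists m0 => m m0m.
have := close_step Mn (H m m0m) (H m.+1 (leqW m0m)); rewrite -/a.
apply: closeW; rewrite -mulrDl mulrCA ler_piMr ?(ltW e0)//.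
by rewrite ler_pdivrMr// mul1r lerDl.
Qed.

Let close_bound n m (C : R) : close n m C C.
Proof.
move=> g gC; have AC := A_bound m gC; rewrite /p.
have /andP[h1 h2] := ev_bound pmu gC.
have : 0 <= \int[P]_w iter m A g (T n w) <= C.
  by apply: Rintegral_bound => //; exact: measurable_fun_countable.
by rewrite ler_norml; lra.
Qed.

(** Once [theta <= n + 1] a step is a convex combination, so the excess of level [m] over the bound
    [b] of level [m + 1] shrinks by [1 - theta/(n+1) <= ((n+1)/(n+2))^theta], and these powers
    telescope. The induction starts from the trivial bound [C]. *)
Let close_decay N m (C b : R) : (M <= N)%N -> theta <= N.+1%:R -> 0 <= b ->
  0 <= C -> (forall n, (N <= n)%N -> close n m.+1 C b) ->
  forall j, close (N + j) m C
    (b + C * powR (N.+1%:R / (N + j).+1%:R) theta).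
Proof.
move=> MN tN b0 C0 H; elim=> [|j IH].
  rewrite addn0 divff ?pnatr_eq0// powR1 mulr1.
  by apply: (@closeW _ _ _ C) (@close_bound _ _ _); rewrite lerDr.
rewrite addnS; have H1 := H _ (leq_addr j N).
have := close_step (leq_trans MN (leq_addr j N)) IH H1; apply: closeW.
set n := (N + j)%N; set a := theta / _.
have a1 : a <= 1.
  rewrite ler_pdivrMr ?ltr0n// mul1r (le_trans tN)// ler_nat ltnS.
  exact: leq_addr.
rewrite ger0_norm ?subr_ge0//.
have -> : powR (N.+1%:R / n.+2%:R) theta =
    powR (N.+1%:R / n.+1%:R) theta * powR (n.+1%:R / n.+2%:R) theta.
  by rewrite -powRM ?divr_ge0// mulrA mulfVK// pnatr_eq0.
set rho := powR (N.+1%:R / _) _; have rho0 : 0 <= rho by exact: powR_ge0.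
have /andP[+ _] := powR_ratio_bounds n theta_gt0; rewrite -/a.
set r := powR _ _ => ar.
have -> : (1 - a) * (b + C * rho) + a * b = b + C * (rho * (1 - a)) by ring.
by rewrite lerD2l ler_wpM2l// ler_wpM2l.
Qed.

Lemma chain_mixing (C e : R) : 0 <= C -> 0 < e ->
  exists N, forall n, (N <= n)%N -> forall g : X -> R,
  (forall i, 0 <= g i <= C) -> `|\int[P]_w g (T n w) - ev mu g| <= e.
Proof.
move=> C0 e0.
have [n0 Mn0 tn0] : exists2 n0, (M <= n0)%N & forall n, (n0 <= n)%N ->
    theta <= n.+1%:R.
  exists (maxn M (Num.Def.archi_bound theta)); first exact: leq_maxl.
  move=> n Hn; apply: (le_trans (ltW (archi_boundP (ltW theta_gt0)))).
  by rewrite ler_nat leqW// (leq_trans (leq_maxr _ _) Hn).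
have d0 : 0 < e / 2 by rewrite divr_gt0.
have [m0 Hm0] := close_init n0 C0 d0.
(* From [n0] on the steps are convex combinations, so a bound valid at time [n0] for all levels
   above [m0] persists with the same [m0]. *)
have tail n m : (n0 <= n)%N -> (m0 <= m)%N -> close n m C (e / 2).
  move/subnKC => <-; elim: (n - n0)%N m => [|j IH] m m0m.
    by rewrite addn0; exact: Hm0.
  rewrite addnS.
  have := close_step (leq_trans Mn0 (leq_addr j n0)) (IH m m0m) (IH m.+1 (leqW m0m)).
  apply: closeW; rewrite ger0_norm; first by rewrite -mulrDl subrK mul1r.
  by rewrite subr_ge0 ler_pdivrMr ?ltr0n// mul1r tn0// leq_addr.
(* The descent from level [m0] to level 0 takes [m0] stages; each may lose [eta], at most [e / 2] in
   total. *)
pose eta := e / 2 / m0.+1%:R.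
have eta0 : 0 < eta by rewrite divr_gt0.
have main k : (k <= m0)%N -> exists2 N, (n0 <= N)%N &
    forall n, (N <= n)%N -> close n (m0 - k) C (e / 2 + k%:R * eta).
  elim: k => [_|k IH km0].
    exists n0 => // n n0n; rewrite subn0 mul0r addr0; exact: tail.
  have [N n0N HN] := IH (ltnW km0).
  have mE : (m0 - k = (m0 - k.+1).+1)%N by rewrite subnSK.
  rewrite mE in HN.
  have b0 : 0 <= e / 2 + k%:R * eta by rewrite addr_ge0 ?(ltW d0)// mulr_ge0 ?ler0n// ltW.
  have D := close_decay (leq_trans Mn0 n0N) (tn0 _ n0N) b0 C0 HN.
  have C10 : 0 < C + 1 by rewrite ltr_wpDl.
  have f0 : 0 < eta / (C + 1) by rewrite divr_gt0.
  have [j0 Hj0] := powR_ratio_small N theta_gt0 f0.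
  exists (N + j0)%N; first by rewrite (leq_trans n0N)// leq_addr.
  move=> n Hn; have Nn : (N <= n)%N by rewrite (leq_trans _ Hn)// leq_addr.
  have j0n : (j0 <= n - N)%N by rewrite leq_subRL.
  have := D (n - N)%N; rewrite subnKC//; apply: closeW.
  rewrite -[k.+1%:R]natr1 mulrDl mul1r addrA lerD2l.
  have := Hj0 _ j0n; rewrite subnKC// => Hp.
  apply: le_trans (ler_wpM2l C0 Hp) _.
  rewrite mulrCA ler_piMr ?(ltW eta0)// ler_pdivrMr// mul1r lerDl.
  exact: ler01.
have [N _ HN] := main m0 (leqnn m0); rewrite subnn in HN.
exists N => n Nn g gC; apply: le_trans (HN n Nn g gC) _.
have : m0%:R * eta <= e / 2.
  rewrite /eta mulrCA ler_piMr ?(ltW d0)// ler_pdivrMr ?ltr0n// mul1r.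
  by rewrite ler_nat.
by move=> ?; lra.
Qed.

(** States are numbered from 0, so after [n] visits the current state is [T (n-1)]. *)
Definition occ_fun n (h : (X -> R) -> X -> R) : R :=
  \int[P]_w h (occupation R T n w) (T n.-1 w).

Lemma occ_funE n h : occ_fun n.+1 h =
  \int[P]_w h (occs R (traj T n.+1 w)) (last x0 (traj T n.+1 w)).
Proof.
by apply: eq_Rintegral => w _; rewrite occupation_traj last_traj.
Qed.

Lemma measurable_occ_fun n (h : (X -> R) -> X -> R) :
  measurable_fun setT (fun w => h (occs R (traj T n w)) (last x0 (traj T n w))).
Proof.
apply: (@measurable_fun_countable _ _ _ _ _ (traj T n)
  (fun s => h (occs R s) (last x0 s))).
exact: (measurable_traj x0).
Qed.

Lemma occ_fun_step n h (C : R) : (forall v i, 0 <= h v i <= C) ->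
  occ_fun n.+2 h = occ_fun n.+1 (step (K n.+1) n.+1 h).
Proof.
move=> hC; rewrite !occ_funE.
have := @Rintegral_traj_next R X x0 _ _ P pi _ T mc (fun n i => pK n.+1 i) n
  (fun s j => if (0 < size s)%N then h (push (size s) (occs R s) j) j
     else h (occs R s) j) C _.
move=> H; transitivity (\int[P]_w
   (fun s j => if (0 < size s)%N then h (push (size s) (occs R s) j) j
     else h (occs R s) j) (traj T n.+1 w) (T n.+1 w)).
  apply: eq_Rintegral => w _; rewrite (traj_rcons T n.+1) last_rcons.
  by rewrite occs_rcons size_mkseq.
rewrite H; last by move=> s j; case: ifP.
by apply: eq_Rintegral => w _; rewrite /step size_mkseq.
Qed.

Lemma occ_fun_dist n h g (C e : R) :
  (forall v i, 0 <= h v i <= C) -> (forall v i, 0 <= g v i <= C) ->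
  (forall v i, unit_box v -> `|h v i - g v i| <= e) ->
  `|occ_fun n.+1 h - occ_fun n.+1 g| <= e.
Proof.
move=> hC gC hg; rewrite !occ_funE; apply: (@Rintegral_dist _ _ _ _ _ _ C) => //.
- exact: measurable_occ_fun.
- exact: measurable_occ_fun.
- by move=> w; apply: hg; exact: unit_box_occs.
Qed.

End inhomogeneous_chain.

(** * The Beta(1,theta) law *)

Lemma is_derive_onem_powR (R : realType) (a x : R) : x < 1 ->
  is_derive x 1 (fun y : R => powR (1 - y) a) (- (a * powR (1 - x) (a - 1))).
Proof.
move=> x1; have d2 : is_derive (1 - x) 1 (fun y : R => powR y a) (a * powR (1 - x) (a - 1)).
  by apply: is_derive1_powR; rewrite subr_gt0.
have d1 : is_derive x 1 ((cst 1 : R -> R) - id) (0 - 1) by exact: is_deriveB.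
by have := is_derive1_comp (g := (cst 1 : R -> R) - id) d2 d1; rewrite sub0r mulrN1.
Qed.

Lemma continuous_onem_powR (R : realType) (a x : R) : x < 1 ->
  {for x, continuous (fun y : R => powR (1 - y) a)}.
Proof.
move=> x1; have [dx _] := is_derive_onem_powR a x1.
by apply: differentiable_continuous; apply/derivable1_diffP.
Qed.

(** The density has antiderivative [- (1 - y)^theta]. The condition [b < 1] keeps the interval away
    from 1, where the density is unbounded if [theta < 1]. *)
Lemma beta1_law_lt (R : realType) (theta b : R) : 0 < theta -> 0 < b -> b < 1 ->
  beta1_law theta `]-oo, b[%classic = (1 - powR (1 - b) theta)%:E.
Proof.
move=> t0 b0 b1; rewrite /beta1_law.
have -> : `]-oo, b[%classic `&` `]0, 1[%classic = `]0, b[%classic :> set R.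
  apply/seteqP; split=> x /=; rewrite !in_itv/=; first by case=> -> /andP[->].
  by move=> /andP[-> xb]; rewrite xb (lt_trans xb b1).
have cont x : x < 1 -> {for x, continuous (fun y : R => theta * powR (1 - y) (theta - 1))}.
  by move=> x1; apply: cvgM; [exact: cvg_cst|exact: continuous_onem_powR].
have mf : measurable_fun `]0, b[%classic
    (fun x : R => (theta * powR (1 - x) (theta - 1))%:E).
  apply/measurable_EFinP; apply: open_continuous_measurable_fun => //.
  by move=> x; rewrite inE /= in_itv/= => /andP[_ xb]; apply: cont; exact: lt_trans b1.
rewrite -(@integral_itv_bndoo R 0 b _ true false mf).
rewrite (@continuous_FTC2 R _ (fun y => - powR (1 - y) theta) 0 b)//.
- by rewrite subr0 powR1 -EFinB opprK addrC.
- apply: continuous_in_subspaceT => x; rewrite inE /= in_itv/= => /andP[_ xb].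
  by apply: cont; exact: le_lt_trans b1.
- have c x : x < 1 -> {for x, continuous (fun y : R => - powR (1 - y) theta)}.
    by move=> x1; apply: cvgN; exact: continuous_onem_powR.
  split.
  + move=> x; rewrite in_itv/= => /andP[_ xb].
    have [d _] := is_derive_onem_powR theta (lt_trans xb b1).
    exact: derivableN.
  + by apply: cvg_at_right_filter; exact: c.
  + by apply: cvg_at_left_filter; exact: c.
- move=> x; rewrite in_itv/= => /andP[_ xb].
  have d := is_derive_onem_powR theta (lt_trans xb b1).
  rewrite derive1E; have [_ ->] := is_deriveN d.
  by rewrite opprK.
Qed.

Section stick_law.
Context (R : realType) (theta : R) d (Omega : measurableType d)
  (P : probability Omega R) (Xb : nat -> Omega -> R).
Hypotheses (theta_gt0 : 0 < theta) (iX : iid_beta1 P theta Xb).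

Definition stick_cdf (b : R) : R :=
  if b <= 0 then 0 else if 1 <= b then 1 else 1 - powR (1 - b) theta.

Let mX k : measurable_fun setT (Xb k). Proof. exact: iX.1. Qed.

Lemma beta1_lawE B : measurable B -> beta1_law theta B = P (Xb 0%N @^-1` B).
Proof.
move=> mB; have := iX.2 0%N (fun=> B) (fun=> mB).
rewrite big_ord_recl big_ord0 mule1 => <-; congr (P _).
by apply/seteqP; split => [w H|w H k]; [exact: H|rewrite leqn0 => /eqP ->].
Qed.

Let mpre k B : measurable B -> measurable (Xb k @^-1` B).
Proof. by move=> mB; rewrite -[_ @^-1` _]setTI; exact: mX. Qed.

Lemma stick_lt b : P (Xb 0%N @^-1` `]-oo, b[) = (stick_cdf b)%:E.
Proof.
rewrite -beta1_lawE// /stick_cdf; case: ifPn => [b0|]; last rewrite -ltNge => b0.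
  rewrite /beta1_law (_ : _ `&` _ = set0) ?integral_set0//.
  apply/seteqP; split=> x //=; rewrite !in_itv/= => -[xb /andP[x0 _]].
  by have := lt_trans x0 xb; rewrite ltNge b0.
case: ifPn => [b1|]; last by rewrite -ltNge => b1; exact: beta1_law_lt.
(* For [b >= 1] no improper integral is computed: the total mass is 1 because [beta1_law] is the law
   of [Xb 0] under a probability. *)
transitivity (beta1_law theta setT); last first.
  by rewrite beta1_lawE// preimage_setT probability_setT.
rewrite /beta1_law; congr (integral _ _ _); rewrite setTI.
apply/seteqP; split=> x /=; rewrite !in_itv/=; first by case.
by move=> /andP[-> x1]; rewrite x1 (lt_le_trans x1 b1).
Qed.

Lemma stick_itv a b : a <= b ->
  P (Xb 0%N @^-1` `[a, b[) = (stick_cdf b - stick_cdf a)%:E.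
Proof.
move=> ab; have -> : Xb 0%N @^-1` `[a, b[ =
    Xb 0%N @^-1` `]-oo, b[ `\` Xb 0%N @^-1` `]-oo, a[.
  apply/seteqP; split=> w /=; rewrite !in_itv/=.
    by move=> /andP[aw wb]; split=> //; apply/negP; rewrite -leNgt.
  by move=> [-> /negP]; rewrite -leNgt => ->.
rewrite measureD; [|exact: mpre|exact: mpre|]; last first.
  by apply: le_lt_trans (probability_le1 _ _) (ltry _); exact: mpre.
rewrite setIidr; last first.
  by move=> w /=; rewrite !in_itv/= => wa; exact: lt_le_trans ab.
by rewrite EFinB -!stick_lt.
Qed.

(* Memorylessness of the Beta(1,theta) law: conditioned on [s <= X_0] it is the
   law of [s + r X_0] with [r = 1 - s]. *)
Lemma stick_memoryless (r a b : R) : 0 < r -> r < 1 -> a <= b ->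
  P (Xb 0%N @^-1` (`[a, b[ `&` `[1 - r, +oo[)) =
  ((powR r theta)%:E *
    P ((fun w => 1 - r + r * Xb 0%N w)%R @^-1` `[a, b[))%E.
Proof.
move=> r0 r1 ab; set s := 1 - r.
have s0 : 0 < s by rewrite subr_gt0.
have -> : (fun w => s + r * Xb 0%N w) @^-1` `[a, b[ =
    Xb 0%N @^-1` `[(a - s) / r, (b - s) / r[.
  apply/seteqP; split=> w /=; rewrite !in_itv/= ler_pdivrMr// ltr_pdivlMr//;
    by rewrite lerBlDl ltrBrDl [_ * r]mulrC.
rewrite stick_itv; last by rewrite ler_pM2r ?invr_gt0// lerD2r.
(* To the right of [s] and below 1 the survival function is [(1 - x)^theta], and
   [1 - x = r * (1 - (x - s) / r)] factors it. *)
have cdfE x : s <= x -> 1 - stick_cdf x = powR r theta * (1 - stick_cdf ((x - s) / r)).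
  move=> sx; have xE : 1 - x = r * (1 - (x - s) / r).
    by rewrite /s; field; rewrite gt_eqF.
  rewrite /stick_cdf leNgt (lt_le_trans s0 sx)/=.
  rewrite [1 <= _ / r]ler_pdivlMr// mul1r.
  have -> : (r <= x - s) = (1 <= x) by rewrite lerBrDr /s addrC subrK.
  case: ifPn => [x1|]; last rewrite -ltNge => x1.
    rewrite leNgt divr_gt0//=; first by rewrite !subrr mulr0.
    by rewrite subr_gt0 (lt_le_trans _ x1)// /s gtrBl.
  rewrite subKr; case: ifPn => y0; last first.
    rewrite subKr -powRM ?(ltW r0)// -?xE//.
    by rewrite -(pmulr_rge0 _ r0) -xE subr_ge0 ltW.
  have xs : x = s.
    by apply/eqP; rewrite eq_le sx andbT -subr_le0 -(pmulr_lle0 _ (_ : 0 < r^-1)) ?invr_gt0.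
  by rewrite subr0 mulr1 xs /s subKr.
have cdf0 x : x <= 0 -> stick_cdf x = 0 by rewrite /stick_cdf => ->.
have cdfs x : x <= s -> stick_cdf ((x - s) / r) = 0.
  by move=> xs; apply: cdf0; rewrite pmulr_lle0 ?invr_gt0// subr_le0.
have [bs|sb] := leP b s.
  rewrite !cdfs//; last exact: le_trans bs.
  rewrite (_ : _ `&` _ = set0) ?preimage_set0 ?measure0 ?subrr ?mule0//.
  apply/seteqP; split=> x //=; rewrite !in_itv/= andbT => -[/andP[_ xb] sx].
  by have := lt_le_trans xb (le_trans bs sx); rewrite ltxx.
(* The condition [s <= x] turns [a] into [max a s]. The other side is unchanged by this, since the
   rescaled distribution function vanishes up to [s]. *)
have -> : `[a, b[ `&` `[s, +oo[ = `[Num.max a s, b[%classic :> set R.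
  apply/seteqP; split=> x /=; rewrite !in_itv/= andbT ge_max.
    by move=> [/andP[-> ->] ->].
  by move=> /andP[/andP[-> ->] ->].
rewrite stick_itv; last by rewrite ge_max ab ltW.
rewrite -EFinM; congr EFin.
have -> : stick_cdf ((a - s) / r) = stick_cdf ((Num.max a s - s) / r).
  by have [as_|sa] := leP a s => //; rewrite subrr mul0r (cdf0 0)// cdfs.
have Hb := cdfE b (ltW sb).
have sm : s <= Num.max a s by rewrite le_max lexx orbT.
have Ha := cdfE _ sm.
move: Ha Hb; rewrite !mulrBr; lra.
Qed.

Lemma stick_small r : 0 < r -> r < 1 ->
  P (Xb 0%N @^-1` `]-oo, (1 - r)%R[) = (1 - powR r theta)%:E.
Proof.
move=> r0 r1; rewrite stick_lt /stick_cdf leNgt subr_gt0 r1/=.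
by rewrite leNgt gtrBl r0/= subKr.
Qed.

End stick_law.

(** * Equality of laws through discretization *)

Definition discr (R : realType) (m : nat) (x : R) : int :=
  Num.floor (x * m.+1%:R).

Definition undiscr (R : realType) (m : nat) (s : seq int) : nat -> R :=
  fun k => (nth 0 s k)%:~R / m.+1%:R.

Definition cell (R : realType) (m : nat) (i : int) : set R :=
  `[i%:~R / m.+1%:R, (i + 1)%:~R / m.+1%:R[%classic.

Lemma discr_cell (R : realType) (m : nat) (x : R) (i : int) :
  discr m x = i <-> cell m i x.
Proof.
rewrite /discr /cell /= in_itv/= ler_pdivrMr ?ltr0n// ltr_pdivlMr ?ltr0n//.
by split=> [/eqP|H]; [rewrite floor_eq|apply/eqP; rewrite floor_eq].
Qed.

Lemma discr_cvg (R : realType) (x : R) :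
  (discr m x)%:~R / m.+1%:R @[m --> \oo] --> x.
Proof.
have hx : (fun m => x - @harmonic R m) @ \oo --> x.
  by rewrite -[X in _ --> X]subr0; apply: cvgB; [exact: cvg_cst|exact: cvg_harmonic].
apply: (squeeze_cvgr _ hx (cvg_cst x)); apply: nearW => m.
have [+ _] := discr_cell m x (discr m x) => /(_ erefl).
rewrite /cell /= in_itv/= => /andP[-> /=]; rewrite andbT /harmonic /=.
by rewrite intrD mulrDl mul1r => /ltW; rewrite -lerBlDr.
Qed.

Section equal_laws.
Context (R : realType) d (Omega : measurableType d) (P : probability Omega R).

Let trajd m n (Z : Omega -> nat -> R) := traj (fun k w => discr m (Z w k)) n.

Lemma measurable_discr m (Z : Omega -> R) : measurable_fun setT Z ->
  forall i, measurable ((fun w => discr m (Z w)) @^-1` [set i]).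
Proof.
move=> mZ i; have -> : (fun w => discr m (Z w)) @^-1` [set i] = Z @^-1` cell m i.
  by apply/seteqP; split=> w /= /discr_cell.
by rewrite -[_ @^-1` _]setTI; apply: mZ => //; exact: measurable_itv.
Qed.

(** Rounding down to the grid turns both integrals into the same countable sum over cells. The
    convergence assumption on [G] expresses continuity along the grids and also dependence on the
    first [n] coordinates only, as [undiscr] reads the others as 0. The factors [c1], [c2] admit
    unnormalized conditional laws. *)
Lemma eq_law_Rintegral n (D1 D2 : set Omega) (Z1 Z2 : Omega -> nat -> R)
    (c1 c2 C : R) (G : (nat -> R) -> R) :
  measurable D1 -> measurable D2 ->
  (forall k, measurable_fun setT (Z1 ^~ k)) ->
  (forall k, measurable_fun setT (Z2 ^~ k)) ->
  0 <= c1 -> 0 <= c2 -> (forall z, 0 <= G z <= C) ->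
  (forall z, G (undiscr R m (mkseq (fun k => discr m (z k)) n)) @[m --> \oo] --> G z) ->
  (forall m (s : seq int), size s = n ->
   c1%:E * P (D1 `&` [set w | forall k, (k < n)%N -> cell m (nth 0%R s k) (Z1 w k)]) =
   c2%:E * P (D2 `&` [set w | forall k, (k < n)%N -> cell m (nth 0%R s k) (Z2 w k)]))%E ->
  c1 * \int[P]_(w in D1) G (Z1 w) = c2 * \int[P]_(w in D2) G (Z2 w).
Proof.
move=> mD1 mD2 mZ1 mZ2 c10 c20 GC Gcvg H.
have G0 z : 0 <= G z by case/andP: (GC z).
have GC' z : `|G z| <= C by rewrite ger0_norm//; case/andP: (GC z).
have mt Z : (forall k, measurable_fun setT (Z ^~ k)) -> forall m s,
    measurable (trajd m n Z @^-1` [set s]).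
  by move=> mZ m s; apply: (measurable_traj 0) => k x; exact: measurable_discr.
have mG Z : (forall k, measurable_fun setT (Z ^~ k)) -> forall m,
    measurable_fun setT (fun w => G (undiscr R m (trajd m n Z w))).
  move=> mZ m; apply: (@measurable_fun_countable _ _ _ _ _ (trajd m n Z)
    (fun s => G (undiscr R m s))); exact: (mt Z mZ m).
have lim Z D : measurable D -> (forall k, measurable_fun setT (Z ^~ k)) ->
    \int[P]_(w in D) G (undiscr R m (trajd m n Z w)) @[m --> \oo] -->
    \int[P]_(w in D) G (Z w).
  move=> mD mZ; have [] // := @cvg_Rintegral_bounded _ _ _ P D
    (fun m w => G (undiscr R m (trajd m n Z w))) (fun w => G (Z w)) C mD.
  - by move=> m; exact: mG.
  - by move=> w; exact: Gcvg.
have E Z D c m : measurable D -> (forall k, measurable_fun setT (Z ^~ k)) -> 0 <= c ->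
    ((c * \int[P]_(w in D) G (undiscr R m (trajd m n Z w)))%:E =
    \esum_(s in [set: seq int]) (c%:E *
      ((G (undiscr R m s))%:E * P (D `&` trajd m n Z @^-1` [set s]))))%E.
  move=> mD mZ c0; rewrite esumZl//; last by move=> s; rewrite mule_ge0// lee_fin.
  rewrite -(@integral_countable _ _ _ P D _ (trajd m n Z)
    (fun s => (G (undiscr R m s))%:E));
    [|by []|exact: (mt Z mZ m)|by move=> s; rewrite lee_fin].
  have I := @bounded_Rintegrable _ _ _ P D _ C mD (mG Z mZ m) (fun w => GC' _).
  by rewrite EFinM /Rintegral fineK//; exact: (integrable_fin_num mD I).
have L1 : c1 * \int[P]_(w in D1) G (undiscr R m (trajd m n Z1 w)) @[m --> \oo]
    --> c1 * \int[P]_(w in D1) G (Z1 w) by apply: cvgM (cvg_cst _) (lim _ _ _ _).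
have L2 : c2 * \int[P]_(w in D2) G (undiscr R m (trajd m n Z2 w)) @[m --> \oo]
    --> c2 * \int[P]_(w in D2) G (Z2 w) by apply: cvgM (cvg_cst _) (lim _ _ _ _).
have L12 m : c1 * \int[P]_(w in D1) G (undiscr R m (trajd m n Z1 w)) =
    c2 * \int[P]_(w in D2) G (undiscr R m (trajd m n Z2 w)).
  apply: EFin_inj; rewrite !E//; apply: eq_esum => s _.
  rewrite muleCA [RHS]muleCA; congr (_ * _)%E.
  rewrite !(traj_preimageE 0); case: ifPn => [/eqP sn|_]; last first.
    by rewrite !setI0 measure0 !mule0.
  have setE Z : [set w | forall k, (k < n)%N -> discr m (Z w k) = nth 0 s k] =
      [set w | forall k, (k < n)%N -> cell m (nth 0 s k) (Z w k)].
    by apply/seteqP; split=> w /= Hw k kn; apply/discr_cell; exact: Hw.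
  by rewrite !setE; exact: H.
move: L1; under eq_fun do rewrite L12.
by move=> L1; exact: (cvg_unique _ L1 L2).
Qed.

End equal_laws.

(** * Conditioning on the first stick *)

Section stick_laws.
Context (R : realType) (theta : R) d (Omega : measurableType d)
  (P : probability Omega R) (Xb : nat -> Omega -> R).
Hypotheses (theta_gt0 : 0 < theta) (iX : iid_beta1 P theta Xb).

Let mX k : measurable_fun setT (Xb k). Proof. exact: iX.1. Qed.

Let mpre k B : measurable B -> measurable (Xb k @^-1` B).
Proof. by move=> mB; rewrite -[_ @^-1` _]setTI; exact: mX. Qed.

Lemma iid_prod n (B : nat -> set R) : (forall k, measurable (B k)) ->
  (P [set w | forall k, (k < n)%N -> B k (Xb k w)] =
   \prod_(k < n) P (Xb 0%N @^-1` B k))%E.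
Proof.
move=> mB; case: n => [|n].
  rewrite big_ord0 (_ : [set _ | _] = setT) ?probability_setT//.
  by apply/seteqP; split.
rewrite (eq_bigr (fun k : 'I_n.+1 => beta1_law theta (B k))); last first.
  by move=> k _; rewrite (beta1_lawE iX).
by rewrite -iX.2.
Qed.

(** On rectangles, the condition on [Xb 0] splits off by independence and the shifted sticks have
    the law of the original ones. *)
Lemma stick_shift n r (G : (nat -> R) -> R) (C : R) : 0 < r -> r < 1 ->
  (forall z, 0 <= G z <= C) ->
  (forall z, G (undiscr R m (mkseq (fun k => discr m (z k)) n)) @[m --> \oo] --> G z) ->
  \int[P]_(w in Xb 0%N @^-1` `]-oo, 1 - r[) G (fun k => Xb k.+1 w) =
  (1 - powR r theta) * \int[P]_w G (Xb ^~ w).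
Proof.
move=> r0 r1 GC Gcvg; rewrite -[LHS]mul1r.
have c0 : 0 <= 1 - powR r theta.
  have := stick_small theta_gt0 iX r0 r1 => H; rewrite -lee_fin -H.
  exact: measure_ge0.
apply: (@eq_law_Rintegral _ _ _ _ n _ _ _ _ _ _ C) => //; first exact: mpre.
move=> m s sn; rewrite mul1e setTI.
pose B k := if k is k'.+1 then cell m (nth 0 s k') else `]-oo, 1 - r[%classic : set R.
have mB k : measurable (B k) by case: k => [|k]; exact: measurable_itv.
have := iid_prod n.+1 mB; rewrite big_ord_recl (stick_small theta_gt0 iX r0 r1).
rewrite (@iid_prod n (fun k => cell m (nth 0 s k))) => [<-|k]; last exact: measurable_itv.
congr (P _); apply/seteqP; split=> w /=.
  by move=> [H0 H1] [|k] //= kn; exact: H1.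
by move=> H; split=> [|k kn]; [exact: (H 0%N)|exact: (H k.+1)].
Qed.

(** On rectangles, this is [stick_memoryless] for the first coordinate and independence for the
    others. *)
Lemma stick_rescale n r (G : (nat -> R) -> R) (C : R) : 0 < r -> r < 1 ->
  (forall z, 0 <= G z <= C) ->
  (forall z, G (undiscr R m (mkseq (fun k => discr m (z k)) n.+1)) @[m --> \oo] --> G z) ->
  \int[P]_(w in Xb 0%N @^-1` `[1 - r, +oo[) G (Xb ^~ w) =
  powR r theta * \int[P]_w G (fun k => if k is 0%N then 1 - r + r * Xb 0%N w else Xb k w).
Proof.
move=> r0 r1 GC Gcvg; rewrite -[LHS]mul1r.
have mf : measurable_fun setT (fun x : R => 1 - r + r * x).
  by apply: measurable_funD => //; exact: measurable_funM.
apply: (@eq_law_Rintegral _ _ _ _ n.+1 _ _ _ _ _ _ C) => //.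
- exact: mpre.
- by case=> // ; exact: (measurableT_comp mf).
- exact: powR_ge0.
move=> m s sn; rewrite mul1e setTI.
pose c : set R := cell m (nth 0 s 0).
pose B k := if k is 0%N then c `&` `[1 - r, +oo[%classic else cell m (nth 0 s k) : set R.
pose B' k := if k is 0%N then (fun x : R => 1 - r + r * x) @^-1` c
  else cell m (nth 0 s k) : set R.
have mc : measurable c by exact: measurable_itv.
have mB k : measurable (B k).
  case: k => [|k]; last exact: measurable_itv.
  by apply: measurableI => //; exact: measurable_itv.
have mB' k : measurable (B' k).
  case: k => [|k]; last exact: measurable_itv.
  by rewrite /B' -[_ @^-1` _]setTI; exact: mf.
have := iid_prod n.+1 mB; have := iid_prod n.+1 mB'; rewrite !big_ord_recl /=.
have -> : [set w | forall k, (k < n.+1)%N -> B k (Xb k w)] =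
    Xb 0%N @^-1` `[1 - r, +oo[ `&`
    [set w | forall k, (k < n.+1)%N -> cell m (nth 0 s k) (Xb k w)].
  apply/seteqP; split=> w /=.
    move=> H; split; first by have [] := H 0%N isT.
    by move=> [|k] kn; [have [] := H 0%N isT|exact: (H k.+1)].
  by move=> [H0 H1] [|k] kn; [split=> //; exact: (H1 0%N)|exact: (H1 k.+1)].
have -> : [set w | forall k, (k < n.+1)%N -> B' k (Xb k w)] =
    [set w | forall k, (k < n.+1)%N -> cell m (nth 0 s k)
      match k with 0%N => 1 - r + r * Xb 0%N w | _.+1 => Xb k w end].
  apply/seteqP; split=> w /= H; move=> [|k] kn; try exact: (H k.+1).
  - exact: (H 0%N).
  - exact: (H 0%N).
move=> -> ->; rewrite muleA; congr (_ * _)%E.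
rewrite /c /cell (stick_memoryless theta_gt0 iX r0 r1)//.
by rewrite ler_pM2r ?invr_gt0 ?ltr0n// ler_int lerDl.
Qed.

End stick_laws.

(** * Stick breaking along a fixed path *)

Definition stick (R : realType) (z : nat -> R) (j : nat) : R :=
  z j * \prod_(i < j) (1 - z i).

Definition mixn (R : realType) (X : countType) (n : nat) (p : nat -> R)
    (x : nat -> X) : X -> R :=
  fun l => \sum_(j < n) p j * (x j == l)%:R.

Section stick_breaking.
Context (R : realType) (X : countType).
Implicit Types (z p : nat -> R) (x : nat -> X).

Lemma stickS z j : stick z j.+1 = (1 - z 0%N) * stick (fun k => z k.+1) j.
Proof. by rewrite /stick big_ord_recl mulrCA. Qed.

(** Self-similarity of stick breaking: what remains after the first break is, up to scale, a mixture
    along the shifted path with one term fewer. *)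
Lemma mixn_stickS n z x l : mixn n.+1 (stick z) x l =
  z 0%N * (x 0%N == l)%:R +
  (1 - z 0%N) * mixn n (stick (fun k => z k.+1)) (fun k => x k.+1) l.
Proof.
rewrite /mixn big_ord_recl {1}/stick big_ord0 mulr1; congr (_ + _).
by rewrite mulr_sumr; apply: eq_bigr => j _; rewrite lift0 stickS -mulrA.
Qed.

Lemma stick_ge0 z j : (forall k, 0 <= z k <= 1) -> 0 <= stick z j.
Proof.
move=> z01; rewrite /stick; apply: mulr_ge0; first by case/andP: (z01 j).
by apply: prodr_ge0 => i _; rewrite subr_ge0; case/andP: (z01 i).
Qed.

Lemma sum_stick z n : (forall k, 0 <= z k <= 1) -> \sum_(j < n) stick z j <= 1.
Proof.
move=> z01.
have -> : \sum_(j < n) stick z j = 1 - \prod_(i < n) (1 - z i).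
  elim: n => [|n IH]; first by rewrite !big_ord0 subrr.
  by rewrite big_ord_recr IH big_ord_recr /= /stick; ring.
rewrite gerBl; apply: prodr_ge0 => i _.
by rewrite subr_ge0; case/andP: (z01 i).
Qed.

Lemma unit_box_mixn n z x : (forall k, 0 <= z k <= 1) ->
  unit_box (mixn n (stick z) x).
Proof.
move=> z01 l; rewrite sumr_ge0 => [/=|j _]; last by rewrite mulr_ge0// stick_ge0.
apply: le_trans (sum_stick n z01); apply: ler_sum => j _.
by rewrite ler_piMr ?stick_ge0//; case: (x j == l).
Qed.

Lemma mixn_cvg n (p : nat -> nat -> R) q x l :
  (forall j, (j < n)%N -> p m j @[m --> \oo] --> q j) ->
  mixn n (p m) x l @[m --> \oo] --> mixn n q x l.
Proof.
move=> pq; apply: cvg_big => [|j _]; last first.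
  by apply: cvgM; [exact: pq|exact: cvg_cst].
by move=> a; exact: add_continuous.
Qed.

Lemma stick_cvg n (z_ : nat -> nat -> R) z j : (j < n)%N ->
  (forall k, (k < n)%N -> z_ m k @[m --> \oo] --> z k) ->
  stick (z_ m) j @[m --> \oo] --> stick z j.
Proof.
move=> jn zz; apply: cvgM; first exact: zz.
apply: cvg_big => [|i _]; last first.
  by apply: cvgB; [exact: cvg_cst|apply: zz; exact: ltn_trans jn].
by move=> a; exact: mul_continuous.
Qed.

Lemma lip_cvg (F : seq X) (L : R) (g : (X -> R) -> R) (v_ : nat -> X -> R) v :
  (forall v w, `|g v - g w| <= L * sdist F v w) ->
  (forall l, v_ m l @[m --> \oo] --> v l) -> g (v_ m) @[m --> \oo] --> g v.
Proof.
move=> gL vv.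
have H : L * sdist F v (v_ m) @[m --> \oo] --> L * \sum_(x <- F) `|v x - v x|.
  apply: cvgM; first exact: cvg_cst.
  rewrite /sdist; elim: F {gL} => [|x F IH].
    by under eq_fun do rewrite big_nil; rewrite big_nil; exact: cvg_cst.
  under eq_fun do rewrite big_cons; rewrite big_cons; apply: cvgD IH.
  by apply: cvg_norm; apply: cvgB; [exact: cvg_cst|exact: vv].
move: H; rewrite [X in _ * X]big1; last by move=> x _; rewrite subrr normr0.
rewrite mulr0 => /cvgrPdist_le H; apply/cvgrPdist_le => e e0.
have := H e e0; apply: filterS => m; rewrite sub0r normrN => Hm.
by apply: le_trans (gL _ _) _; apply: le_trans (ler_norm _) Hm.
Qed.

End stick_breaking.

Section stick_identity.
Context (R : realType) (X : countType) (theta : R) d (Omega : measurableType d)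
  (P : probability Omega R) (Xb : nat -> Omega -> R) (F : seq X).
Hypotheses (theta_gt0 : 0 < theta) (iX : iid_beta1 P theta Xb).
Hypothesis X01 : forall k w, 0 < Xb k w < 1.

Let mX k : measurable_fun setT (Xb k). Proof. exact: iX.1. Qed.

Let X01' w k : 0 <= Xb k w <= 1.
Proof. by have /andP[a b] := X01 k w; rewrite !ltW. Qed.

Let G n x (g : (X -> R) -> R) (z : nat -> R) := g (mixn n (stick z) x).

Let G_cvg n x g (L : R) : (forall v w, `|g v - g w| <= L * sdist F v w) ->
  forall n', (n <= n')%N -> forall z,
  G n x g (undiscr R m (mkseq (fun k => discr m (z k)) n')) @[m --> \oo] --> G n x g z.
Proof.
move=> gL n' nn' z; rewrite /G; apply: (lip_cvg gL) => l; apply: mixn_cvg => j jn.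
apply: (stick_cvg jn) => k kn; rewrite /undiscr.
under eq_fun do rewrite nth_mkseq ?(leq_trans kn nn')//.
exact: discr_cvg.
Qed.

(** Measurability is inherited in the limit from the rounded sticks, which have countably many
    values. *)
Lemma measurable_mixn n x (g : (X -> R) -> R) (L : R) :
  (forall v w, `|g v - g w| <= L * sdist F v w) ->
  measurable_fun setT (fun w => g (mixn n (stick (Xb ^~ w)) x)).
Proof.
move=> gL; apply/measurable_EFinP.
apply: (@emeasurable_fun_cvg _ _ _ setT (fun m w => (G n x g (undiscr R m
   (mkseq (fun k => discr m (Xb k w)) n)))%:E)) => [m|w _].
  apply/measurable_EFinP.
  apply: (@measurable_fun_countable _ _ _ _ _ (traj (fun k w => discr m (Xb k w)) n)
    (fun s => G n x g (undiscr R m s))).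
  by apply: (measurable_traj 0) => k i; exact: measurable_discr.
apply: cvg_EFin; first exact: nearW.
exact: (@G_cvg n x g L gL n (leqnn n) (Xb ^~ w)).
Qed.

Lemma measurable_mixn_shift n x (g : (X -> R) -> R) (L : R) :
  (forall v w, `|g v - g w| <= L * sdist F v w) ->
  measurable_fun setT (fun w => g (mixn n (stick (fun k => Xb k.+1 w)) x)).
Proof.
move=> gL; apply/measurable_EFinP.
apply: (@emeasurable_fun_cvg _ _ _ setT (fun m w => (G n x g (undiscr R m
   (mkseq (fun k => discr m (Xb k.+1 w)) n)))%:E)) => [m|w _].
  apply/measurable_EFinP.
  apply: (@measurable_fun_countable _ _ _ _ _ (traj (fun k w => discr m (Xb k.+1 w)) n)
    (fun s => G n x g (undiscr R m s))).
  by apply: (measurable_traj 0) => k i; exact: measurable_discr.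
apply: cvg_EFin; first exact: nearW.
exact: (@G_cvg n x g L gL n (leqnn n) (fun k => Xb k.+1 w)).
Qed.

Definition stick_mean n (x : nat -> X) (g : (X -> R) -> R) : R :=
  \int[P]_w g (mixn n (stick (Xb ^~ w)) x).

Lemma stick_mean_bound n x g (C L : R) : (forall v, 0 <= g v <= C) ->
  (forall v w, `|g v - g w| <= L * sdist F v w) -> 0 <= stick_mean n x g <= C.
Proof.
by move=> gC gL; apply: Rintegral_bound => //; exact: measurable_mixn gL.
Qed.

(** On [X_0 >= 1 - r] memorylessness is exact and turns the mixture [v] into
    [r v + (1 - r) delta_(x 0)]. On [X_0 < 1 - r], of probability [1 - r^theta], dropping the first
    stick moves each coordinate by at most [X_0 < 1 - r] and leaves [n] terms along the shifted
    path. With [1 - r] of order [1/n] the error is thus of second order. *)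
Lemma stick_mean_step n x (g : (X -> R) -> R) (C L r : R) : 0 < r -> r < 1 ->
  0 <= L -> (forall v, 0 <= g v <= C) ->
  (forall v w, `|g v - g w| <= L * sdist F v w) ->
  `|stick_mean n.+1 x g
    - (powR r theta *
         stick_mean n.+1 x (fun v => g (fun l => r * v l + (1 - r) * (x 0%N == l)%:R))
       + (1 - powR r theta) * stick_mean n (fun k => x k.+1) g)|
  <= (1 - powR r theta) * (L * ((1 - r) * (size F)%:R)).
Proof.
move=> r0 r1 L0 gC gL.
pose D1 := Xb 0%N @^-1` `[1 - r, +oo[; pose D2 := Xb 0%N @^-1` `]-oo, 1 - r[.
have mpre B : measurable B -> measurable (Xb 0%N @^-1` B).
  by move=> mB; rewrite -[_ @^-1` _]setTI; exact: mX.
have mD1 : measurable D1 by exact: mpre.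
have mD2 : measurable D2 by exact: mpre.
have DT : D1 `|` D2 = setT.
  apply/seteqP; split=> // w _; rewrite /D1 /D2 /= !in_itv/= andbT.
  by have [|] := leP (1 - r) (Xb 0%N w); [left|right].
have D12 : [disjoint D1 & D2].
  apply/disj_setPS => w [] /=; rewrite /D1 /D2 /= !in_itv/= andbT => a b.
  by have := le_lt_trans a b; rewrite ltxx.
have GC y x' v : 0 <= G y x' g v <= C by exact: gC.
have mg y x' : measurable_fun setT (fun w => g (mixn y (stick (Xb ^~ w)) x')).
  exact: measurable_mixn gL.
have gn v : `|g v| <= C by rewrite ger0_norm; case/andP: (gC v).
have I D y x' : measurable D ->
    P.-integrable D (EFin \o (fun w => g (mixn y (stick (Xb ^~ w)) x'))).
  by move=> mD; apply: (@bounded_Rintegrable _ _ _ _ _ _ C).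
rewrite {1}/stick_mean -DT Rintegral_setU//; last by rewrite DT; exact: I.
rewrite (@stick_rescale R theta _ _ P Xb theta_gt0 iX n r (G n.+1 x g) C r0 r1)//;
  last exact: (@G_cvg n.+1 x g L gL _ (leqnn _)).
have -> : \int[P]_w G n.+1 x g (fun k => if k is 0%N then 1 - r + r * Xb 0%N w
      else Xb k w) =
    stick_mean n.+1 x (fun v => g (fun l => r * v l + (1 - r) * (x 0%N == l)%:R)).
  apply: eq_Rintegral => w _; rewrite /G; congr g; apply/funext => l.
  by rewrite !mixn_stickS; ring.
have Sh := stick_shift theta_gt0 iX r0 r1 (GC n (fun k => x k.+1))
  (@G_cvg n (fun k => x k.+1) g L gL n (leqnn n)).
rewrite -[(1 - powR r theta) * stick_mean _ _ _]Sh opprD addrACA subrr add0r.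
pose f2 w := g (mixn n (stick (fun k => Xb k.+1 w)) (fun k => x k.+1)).
have mf2 : measurable_fun setT f2.
  exact: (measurable_mixn_shift n (fun k => x k.+1) gL).
have I2 : P.-integrable D2 (EFin \o f2).
  by apply: (@bounded_Rintegrable _ _ _ _ _ _ C) => // w; exact: gn.
rewrite -[X in _ - X]/(\int[P]_(w in D2) f2 w) -RintegralB//; last exact: I.
set e := L * ((1 - r) * (size F)%:R).
have e0 : 0 <= e by rewrite !mulr_ge0// subr_ge0 ltW.
have mB : measurable_fun setT
    (fun w => g (mixn n.+1 (stick (Xb ^~ w)) x) - f2 w) by exact: measurable_funB.
have bB w : `|g (mixn n.+1 (stick (Xb ^~ w)) x) - f2 w| <= C + C.
  by apply: le_trans (ler_normB _ _) _; apply: lerD; exact: gn.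
have IB := bounded_Rintegrable P mD2 mB bB.
apply: le_trans (le_normr_Rintegral mD2 IB) _.
have -> : (1 - powR r theta) * e = \int[P]_(w in D2) (cst e w).
  rewrite /= Rintegral_cst// mulrC; congr (_ * _).
  by rewrite /D2 [X in fine X](stick_small theta_gt0 iX r0 r1).
apply: le_Rintegral => //.
- apply: (@bounded_Rintegrable _ _ _ _ _
    (fun w => `|g (mixn n.+1 (stick (Xb ^~ w)) x) - f2 w|) (C + C)) => //.
    by apply: measurableT_comp.
  by move=> w; rewrite normr_id.
- exact: (@bounded_Rintegrable _ _ _ _ _ (cst e) `|e|).
move=> w; rewrite /D2 /= in_itv/= => X0r.
apply: le_trans (gL _ _) _; rewrite /e ler_wpM2l//; apply: sdist_le => l.
rewrite mixn_stickS; set v := mixn _ _ _ _; set dl := (_ == _)%:R.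
have -> : Xb 0%N w * dl + (1 - Xb 0%N w) * v - v = Xb 0%N w * (dl - v) by ring.
have /andP[X0 X1] := X01 0%N w.
rewrite normrM ger0_norm ?ltW//.
have : `|dl - v| <= 1.
  have vb : unit_box (mixn n (stick (fun k => Xb k.+1 w)) (fun k => x k.+1)).
    by apply: unit_box_mixn => k; exact: X01'.
  have := vb l; rewrite -/v ler_norml /dl.
  by case: (x 0%N == l) => /andP[] /=; lra.
have n0 : 0 <= `|dl - v| by [].
by move: n0; set u := `|_|; nra.
Qed.

End stick_identity.

(** * Averaging over the path *)

Lemma prob_vec_law (R : realType) d (Omega : measurableType d)
    (P : probability Omega R) (Y : countType) (V : Omega -> Y) :
  (forall y, measurable (V @^-1` [set y])) ->
  prob_vec (fun y => fine (P (V @^-1` [set y]))) /\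
  forall y, P (V @^-1` [set y]) = (fine (P (V @^-1` [set y])))%:E.
Proof.
move=> mV; have E y : P (V @^-1` [set y]) = (fine (P (V @^-1` [set y])))%:E.
  by rewrite fineK//; exact: fin_num_measure.
split=> //; split=> [y|]; first by rewrite fine_ge0.
under eq_esum do rewrite -E.
have := @integral_countable _ _ R P setT Y V (fun=> 1%E) measurableT mV
  (fun=> lee01).
under eq_esum do rewrite mul1e setTI.
by move=> <-; rewrite integral_cst// mul1e; exact: probability_setT.
Qed.

Lemma Rintegral_ev (R : realType) d (Omega : measurableType d)
    (P : probability Omega R) (X : countType) (p : X -> R)
    (f : X -> Omega -> R) (C : R) : prob_vec p ->
  (forall i, measurable_fun setT (f i)) -> (forall i w, 0 <= f i w <= C) ->
  ev p (fun i => \int[P]_w f i w) = \int[P]_w ev p (fun i => f i w).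
Proof.
move=> pp mf fC; rewrite /ev /Rintegral; congr fine.
have f0 i w : 0 <= f i w by case/andP: (fC i w).
have fn i w : `|f i w| <= C by rewrite ger0_norm//; case/andP: (fC i w).
pose u n w := oapp (fun i => (p i * f i w)%:E) 0%E (pickle_inv n).
have u0 n w : (0 <= u n w)%E.
  by rewrite /u; case: (pickle_inv n) => //= i; rewrite lee_fin mulr_ge0// pp.1.
have mu n : measurable_fun setT (u n).
  rewrite /u; case: (pickle_inv n) => [i|] /=; last exact: measurable_cst.
  by apply/measurable_EFinP; apply: measurable_funM => //; exact: measurable_cst.
transitivity (\int[P]_w \sum_(n <oo) u n w)%E; last first.
  apply: eq_integral => w _.
  rewrite -(esum_countTypeE (a := fun i => (p i * f i w)%:E)).
    by rewrite fineK// (ev_fin pp (fun i => fC i w)).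
  by move=> i; rewrite lee_fin mulr_ge0// pp.1.
rewrite integral_nneseries//.
rewrite esum_countTypeE; last first.
  by move=> i; rewrite lee_fin mulr_ge0 ?pp.1// Rintegral_ge0.
apply: eq_eseriesr => n _; rewrite /u; case: (pickle_inv n) => [i|] /=; last first.
  by rewrite integral0.
under [RHS]eq_integral do rewrite EFinM.
have I := bounded_Rintegrable P measurableT (mf i) (fn i).
rewrite integralZl// EFinM fineK//; exact: (integrable_fin_num measurableT I).
Qed.

Section gem.
Context (R : realType) (X : countType) (x0 : X) (theta : R) (Q : X -> X -> R)
  (mu : X -> R) d (Omega : measurableType d) (P : probability Omega R)
  (Pp Xb : nat -> Omega -> R) (Tp : nat -> Omega -> X) (F : seq X).
Hypotheses (theta_gt0 : 0 < theta) (sQ : stochastic Q) (sm : stationary Q mu).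
Hypotheses (iX : iid_beta1 P theta Xb) (X01 : forall k w, 0 < Xb k w < 1).
Hypothesis PpE : forall j w, Pp j w = stick (Xb ^~ w) j.
Hypotheses (mc : markov_chain P mu (fun _ => Q) Tp) (ind : indep_seq P Tp Pp).

Local Notation Q' := (Qtp theta Q mu).

Let mT : forall k x, measurable (Tp k @^-1` [set x]). Proof. by case: mc. Qed.

Let X01' w k : 0 <= Xb k w <= 1.
Proof. by have /andP[a b] := X01 k w; rewrite !ltW. Qed.

Let mP k : measurable_fun setT (Pp k).
Proof.
have -> : Pp k = fun w => Xb k w * \prod_(i < k) (1 - Xb i w).
  by apply/funext => w; rewrite PpE.
apply: measurable_funM; first exact: iX.1.
elim: k => [|k IH].
  by under eq_fun do rewrite big_ord0; exact: measurable_cst.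
under eq_fun do rewrite big_ord_recr; apply: measurable_funM => //=.
by apply: measurable_funB; [exact: measurable_cst|exact: iX.1].
Qed.

Let mixn_traj n p w : mixn n.+1 p (nth x0 (traj Tp n.+1 w)) =
  mixn n.+1 p (Tp ^~ w) :> (X -> R).
Proof.
by apply/funext => l; apply: eq_bigr => j _; rewrite nth_mkseq.
Qed.

Let hd_traj n w : nth x0 (traj Tp n.+1 w) 0 = Tp 0%N w.
Proof. by rewrite nth_mkseq. Qed.

Definition mix_mean n (h : (X -> R) -> X -> R) : R :=
  \int[P]_w h (mixn n (Pp ^~ w) (Tp ^~ w)) (Tp 0%N w).

Let trajP m n := traj (fun k w => discr m (Pp k w)) n.

Let indep_traj m n s a :
  P (traj Tp n.+1 @^-1` [set s] `&` trajP m n.+1 @^-1` [set a]) =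
  (P (traj Tp n.+1 @^-1` [set s]) * P (trajP m n.+1 @^-1` [set a]))%E.
Proof.
rewrite (traj_preimageE x0) (traj_preimageE 0).
case: ifPn => _; last by rewrite set0I measure0 mul0e.
case: ifPn => _; last by rewrite setI0 measure0 mule0.
have -> : [set w | forall k, (k < n.+1)%N -> discr m (Pp k w) = nth 0 a k] =
    [set w | forall k, (k <= n)%N -> cell m (nth 0 a k) (Pp k w)].
  by apply/seteqP; split=> w /= H k kn; apply/discr_cell; exact: H.
apply: (@ind n (nth x0 s) (fun k => cell m (nth 0 a k))) => k.
exact: measurable_itv.
Qed.

(** Independence is assumed for [Pp] on rectangles, so [Pp] is discretized; against a countable path
    the joint law is then a constant kernel. Refining the grid passes to the limit both in the joint
    integral and in the iterated one. *)
Lemma mix_mean_indep n h (C L : R) : lipclass F C L h ->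
  measurable_fun setT (fun w => h (mixn n.+1 (Pp ^~ w) (Tp ^~ w)) (Tp 0%N w)) /\
  mix_mean n.+1 h =
    \int[P]_w stick_mean P Xb n.+1 (Tp ^~ w) (h ^~ (Tp 0%N w)).
Proof.
move=> [hC hL].
have hn v i : `|h v i| <= C by rewrite ger0_norm; case/andP: (hC v i).
pose phi m (s : seq X) (a : seq int) :=
  h (mixn n.+1 (undiscr R m a) (nth x0 s)) (nth x0 s 0).
have mU s : measurable (traj Tp n.+1 @^-1` [set s]) by exact: (measurable_traj x0).
have mV m a : measurable (trajP m n.+1 @^-1` [set a]).
  by apply: (measurable_traj 0) => k x; exact: measurable_discr.
have phiC m s a : 0 <= phi m s a <= C by exact: hC.
have phi_cvg w w' : phi m (traj Tp n.+1 w) (trajP m n.+1 w') @[m --> \oo] -->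
    h (mixn n.+1 (Pp ^~ w') (Tp ^~ w)) (Tp 0%N w).
  rewrite /phi; under eq_fun do rewrite mixn_traj hd_traj.
  apply: (@lip_cvg _ _ F L (h ^~ (Tp 0%N w))) => [v v'|l]; first exact: hL.
  apply: mixn_cvg => j jn; rewrite /undiscr.
  by under eq_fun do rewrite nth_mkseq//; exact: discr_cvg.
have mphi m : measurable_fun setT
    (fun w => phi m (traj Tp n.+1 w) (trajP m n.+1 w)).
  apply: (@measurable_fun_countable _ _ _ _ _
    (fun w => (traj Tp n.+1 w, trajP m n.+1 w)) (fun sa => phi m sa.1 sa.2)).
  move=> [s a]; rewrite (_ : _ @^-1` _ =
      traj Tp n.+1 @^-1` [set s] `&` trajP m n.+1 @^-1` [set a]).
    exact: measurableI.
  by apply/seteqP; split => w /=; [case=> -> ->|case=> -> ->].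
have [mlim _ L1] := @cvg_Rintegral_bounded _ _ _ P setT
  (fun m w => phi m (traj Tp n.+1 w) (trajP m n.+1 w))
  (fun w => h (mixn n.+1 (Pp ^~ w) (Tp ^~ w)) (Tp 0%N w)) C measurableT
  mphi (fun m w => hn _ _) (fun w => phi_cvg w w).
split=> //.
have mphi2 m s : measurable_fun setT (fun w' => phi m s (trajP m n.+1 w')).
  exact: (@measurable_fun_countable _ _ _ _ _ (trajP m n.+1) (phi m s)).
have inner w : \int[P]_w' phi m (traj Tp n.+1 w) (trajP m n.+1 w') @[m --> \oo]
    --> stick_mean P Xb n.+1 (Tp ^~ w) (h ^~ (Tp 0%N w)).
  have [_ _] := @cvg_Rintegral_bounded _ _ _ P setT
    (fun m w' => phi m (traj Tp n.+1 w) (trajP m n.+1 w'))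
    (fun w' => h (mixn n.+1 (Pp ^~ w') (Tp ^~ w)) (Tp 0%N w)) C measurableT
    (fun m => mphi2 m _) (fun m w' => hn _ _) (fun w' => phi_cvg w w').
  rewrite [X in _ --> X -> _](_ : _ = stick_mean P Xb n.+1 (Tp ^~ w) (h ^~ (Tp 0%N w)))//.
  apply: eq_Rintegral => w' _; congr (h _ _); apply/funext => l.
  by apply: eq_bigr => j _; rewrite PpE.
have mouter m : measurable_fun setT
    (fun w => \int[P]_w' phi m (traj Tp n.+1 w) (trajP m n.+1 w')).
  exact: (@measurable_fun_countable _ _ _ _ _ (traj Tp n.+1)
    (fun s => \int[P]_w' phi m s (trajP m n.+1 w'))).
have bouter m w : `|\int[P]_w' phi m (traj Tp n.+1 w) (trajP m n.+1 w')| <= C.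
  have /andP[a b] := Rintegral_bound P (mphi2 m (traj Tp n.+1 w)) (fun w' => phiC m _ _).
  by rewrite ger0_norm.
have [_ _ L2] := @cvg_Rintegral_bounded _ _ _ P setT _ _ C measurableT
  mouter bouter inner.
have E m : \int[P]_w phi m (traj Tp n.+1 w) (trajP m n.+1 w) =
    \int[P]_w \int[P]_w' phi m (traj Tp n.+1 w) (trajP m n.+1 w').
  have [pl plE] := prob_vec_law P (mV m).
  rewrite (@Rintegral_kernel _ _ _ _ _ P P _ _ (traj Tp n.+1) (trajP m n.+1)
    (traj Tp n.+1) (fun _ a => fine (P (trajP m n.+1 @^-1` [set a]))) (phi m) C)//.
    apply: eq_Rintegral => w _; symmetry.
    exact: (@Rintegral_countable _ _ _ P _ (trajP m n.+1) _ _ C).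
  by move=> s a; rewrite -plE; exact: indep_traj.
move: L1; under eq_fun do rewrite E.
by move=> L1; exact: (cvg_unique _ L1 L2).
Qed.


Let pQ' i : prob_vec (Q' i).
Proof. exact: prob_vec_Qtp. Qed.

Definition mean_field (h : (X -> R) -> X -> R) : (X -> R) -> X -> R :=
  fun v j => ev (Q' j) (h v).

(** The effect on the mixture of replacing the first stick [X_0] by [1 - r + r X_0], where [i] is
    the first state of the path. *)
Definition slide (r : R) (h : (X -> R) -> X -> R) : (X -> R) -> X -> R :=
  fun v i => h (fun l => r * v l + (1 - r) * (i == l)%:R) i.

Lemma lipclass_mean_field h (C L : R) : lipclass F C L h ->
  lipclass F C L (mean_field h).
Proof.
move=> [hC hL]; split=> [v i|v w i]; first exact: ev_bound.
by apply: (@ev_dist _ _ _ _ _ C) => // j; exact: hL.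
Qed.

Lemma lipclass_slide h (C L r : R) : 0 <= r -> r <= 1 -> 0 <= L ->
  lipclass F C L h -> lipclass F C L (slide r h).
Proof.
move=> r0 r1 L0 [hC hL]; split=> [v i|v w i]; first exact: hC.
apply: le_trans (hL _ _ _) _; rewrite ler_wpM2l// -[X in _ <= X]mul1r.
apply: sdist_homo => // l.
rewrite opprD addrACA subrr addr0 -mulrBr normrM ger0_norm// mul1r.
by rewrite ler_piMl.
Qed.

Let stick_mean_ext n (x y : nat -> X) g : (forall k, (k < n)%N -> x k = y k) ->
  stick_mean P Xb n x g = stick_mean P Xb n y g.
Proof.
move=> xy; apply: eq_Rintegral => w _; congr g; apply/funext => l.
by apply: eq_bigr => j _; rewrite xy.
Qed.

(** Detailed balance moves the initial weight from [T'_0] to [T'_1]: given [(T'_1, ..., T'_(n+1))],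
    which is distributed as [(T'_0, ..., T'_n)], the state [T'_0] is drawn from [Q'] at [T'_1]. *)
Lemma mix_mean_reverse n h (C L : R) : lipclass F C L h ->
  \int[P]_w stick_mean P Xb n.+1 (fun k => Tp k.+1 w) (h ^~ (Tp 0%N w)) =
  mix_mean n.+1 (mean_field h).
Proof.
move=> hl; have [hC hL] := hl.
have smC x i : 0 <= stick_mean P Xb n.+1 x (h ^~ i) <= C.
  apply: (stick_mean_bound iX _ _ (L := L) (F := F)) => // v; exact: hC.
have H := @Rintegral_kernel _ _ _ _ _ P P _ _
  (traj (fun k => Tp k.+1) n.+1) (Tp 0%N) (traj Tp n.+1)
  (fun s i => Q' (nth x0 s 0) i)
  (fun s i => stick_mean P Xb n.+1 (nth x0 s) (h ^~ i)) C.
transitivity (\int[P]_w stick_mean P Xb n.+1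
    (nth x0 (traj (fun k => Tp k.+1) n.+1 w)) (h ^~ (Tp 0%N w))).
  apply: eq_Rintegral => w _; apply: stick_mean_ext => k kn.
  by rewrite nth_mkseq.
rewrite H//; last 3 first.
- by move=> s; exact: (measurable_traj x0).
- by move=> s; exact: (measurable_traj x0).
- move=> s i; have [sn|sn] := eqVneq (size s) n.+1; last first.
    by rewrite !(traj_preimageE x0) (negbTE sn) set0I measure0 mul0e.
  have -> : traj (fun k => Tp k.+1) n.+1 @^-1` [set s] `&` Tp 0%N @^-1` [set i] =
      traj Tp n.+2 @^-1` [set i :: s].
    rewrite !(traj_preimageE x0) /= sn eqxx eqSS eqxx.
    apply/seteqP; split=> [w [/= H1 H2] [|k] kn //|w /= Hw]; first exact: H1.
    by split=> [k kn|]; [exact: (Hw k.+1)|exact: (Hw 0%N)].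
  rewrite (traj_law x0 mc (n := n.+1)) /= ?sn//.
  rewrite (traj_law x0 mc (n := n)) ?sn//.
  rewrite big_ord_recl /= -EFinM mulrA (detailed_balance theta_gt0 sQ sm).
  by congr EFin; rewrite -!mulrA; congr (_ * _); rewrite mulrC.
have [_ ->] := mix_mean_indep n (lipclass_mean_field hl).
apply: eq_Rintegral => w _; rewrite hd_traj /mean_field.
rewrite /stick_mean -(@Rintegral_ev _ _ _ P _ (Q' (Tp 0%N w))
  (fun i w' => h (mixn n.+1 (stick (Xb ^~ w')) (Tp ^~ w)) i) C)//.
- congr ev; apply/funext => i.
  apply: (@stick_mean_ext n.+1 (nth x0 (traj Tp n.+1 w)) (Tp ^~ w) (h ^~ i)) => k kn.
  by rewrite nth_mkseq.
- by move=> i; apply: (measurable_mixn iX (F := F) (L := L) n.+1 (Tp ^~ w) (g := h ^~ i)).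
Qed.

Lemma mix_mean_step n h (C L r : R) : 0 < r -> r < 1 -> 0 <= L ->
  lipclass F C L h ->
  `|mix_mean n.+2 h - (powR r theta * mix_mean n.+2 (slide r h) +
     (1 - powR r theta) * mix_mean n.+1 (mean_field h))| <=
  (1 - powR r theta) * (L * ((1 - r) * (size F)%:R)).
Proof.
move=> r0 r1 L0 hl; have [hC hL] := hl.
have sl := lipclass_slide (ltW r0) (ltW r1) L0 hl.
rewrite -(mix_mean_reverse n hl).
have [_ ->] := mix_mean_indep n.+1 hl; have [_ ->] := mix_mean_indep n.+1 sl.
pose A w := stick_mean P Xb n.+2 (Tp ^~ w) (h ^~ (Tp 0%N w)).
pose B w := stick_mean P Xb n.+2 (Tp ^~ w) ((slide r h) ^~ (Tp 0%N w)).
pose D w := stick_mean P Xb n.+1 (fun k => Tp k.+1 w) (h ^~ (Tp 0%N w)).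
rewrite -[X in `|X - _|]/(\int[P]_w A w).
rewrite -[X in _ * X + _]/(\int[P]_w B w) -[X in _ + _ * X]/(\int[P]_w D w).
have mU s : measurable (traj Tp n.+2 @^-1` [set s]) by exact: (measurable_traj x0).
have mtr (f : seq X -> R) (g : Omega -> R) : (forall w, g w = f (traj Tp n.+2 w)) ->
    measurable_fun setT g.
  by move=> E; rewrite (funext E); exact: (@measurable_fun_countable _ _ _ _ _ _ f).
have mA : measurable_fun setT A.
  apply: (mtr (fun s => stick_mean P Xb n.+2 (nth x0 s) (h ^~ (nth x0 s 0)))) => w.
  by rewrite hd_traj; apply: stick_mean_ext => k kn; rewrite nth_mkseq.
have mB : measurable_fun setT B.
  apply: (mtr (fun s => stick_mean P Xb n.+2 (nth x0 s)
    ((slide r h) ^~ (nth x0 s 0)))) => w.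
  by rewrite hd_traj; apply: stick_mean_ext => k kn; rewrite nth_mkseq.
have mD : measurable_fun setT D.
  apply: (mtr (fun s => stick_mean P Xb n.+1 (fun k => nth x0 s k.+1)
    (h ^~ (nth x0 s 0)))) => w.
  by rewrite hd_traj; apply: stick_mean_ext => k kn; rewrite nth_mkseq.
have bA w : 0 <= A w <= C.
  apply: (stick_mean_bound iX _ _ (L := L) (F := F)) => [v|v v']; first exact: hC.
  exact: hL.
have bB w : 0 <= B w <= C.
  apply: (stick_mean_bound iX _ _ (L := L) (F := F)) => [v|v v']; first exact: sl.1.
  exact: sl.2.
have bD w : 0 <= D w <= C.
  apply: (stick_mean_bound iX _ _ (L := L) (F := F)) => [v|v v']; first exact: hC.
  exact: hL.
have rho0 : 0 <= powR r theta by exact: powR_ge0.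
have rho1 : 0 <= 1 - powR r theta.
  by rewrite -lee_fin -(stick_small theta_gt0 iX r0 r1); exact: measure_ge0.
have IB : P.-integrable setT (EFin \o B).
  by apply: (@bounded_Rintegrable _ _ _ _ _ _ C) => // w; exact: ge0_le_norm.
have ID : P.-integrable setT (EFin \o D).
  by apply: (@bounded_Rintegrable _ _ _ _ _ _ C) => // w; exact: ge0_le_norm.
have mB' : measurable_fun setT (fun w => powR r theta * B w).
  by apply: measurable_funM => //; exact: measurable_cst.
have mD' : measurable_fun setT (fun w => (1 - powR r theta) * D w).
  by apply: measurable_funM => //; exact: measurable_cst.
rewrite -!RintegralZl// -RintegralD//; last 2 first.
- apply: (@bounded_Rintegrable _ _ _ _ _ _ (powR r theta * C)) => // w.
  by rewrite normrM ger0_norm// ler_wpM2l// ge0_le_norm.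
- apply: (@bounded_Rintegrable _ _ _ _ _ _ ((1 - powR r theta) * C)) => // w.
  by rewrite normrM ger0_norm// ler_wpM2l// ge0_le_norm.
apply: (@Rintegral_dist _ _ _ _ _ _ C) => //.
- exact: measurable_funD.
- move=> w; have /andP[b0 b1] := bB w; have /andP[d0 d1] := bD w.
  rewrite addr_ge0 ?mulr_ge0//=.
  rewrite (_ : C = powR r theta * C + (1 - powR r theta) * C); last by ring.
  by rewrite lerD// ler_wpM2l.
- move=> w; exact: (@stick_mean_step R X theta _ _ P Xb F theta_gt0 iX X01 n.+1
    (Tp ^~ w) (h ^~ (Tp 0%N w)) C L r r0 r1 L0 (hC ^~ _) (fun v v' => hL v v' _)).
Qed.

End gem.

(** * The infinite mixture and its almost invariance *)

Section gem_limit.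
Context (R : realType) (X : countType) (x0 : X) (theta : R) (Q : X -> X -> R)
  (mu : X -> R) (M : nat) d (Omega : measurableType d) (P : probability Omega R)
  (Pp Xb : nat -> Omega -> R) (Tp : nat -> Omega -> X) (F : seq X).
Hypotheses (theta_gt0 : 0 < theta) (sQ : stochastic Q) (sm : stationary Q mu).
Hypotheses (iX : iid_beta1 P theta Xb) (X01 : forall k w, 0 < Xb k w < 1).
Hypothesis PpE : forall j w, Pp j w = stick (Xb ^~ w) j.
Hypotheses (mc : markov_chain P mu (fun _ => Q) Tp) (ind : indep_seq P Tp Pp).
Hypothesis M_big : M_threshold (Gtp theta Q mu) < M%:R.

Let X01' w k : 0 <= Xb k w <= 1.
Proof. by have /andP[a b] := X01 k w; rewrite !ltW. Qed.

Let PpE' w : Pp ^~ w = stick (Xb ^~ w).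
Proof. by apply/funext => j; exact: PpE. Qed.

Let Pp_ge0 w j : 0 <= Pp j w.
Proof. by rewrite PpE; exact: stick_ge0. Qed.

Lemma unit_box_mixn_gem n w : unit_box (mixn n (Pp ^~ w) (Tp ^~ w)).
Proof. by rewrite PpE'; apply: unit_box_mixn. Qed.

Lemma mixn_gem_cvg w l :
  mixn n (Pp ^~ w) (Tp ^~ w) l @[n --> \oo] --> gem_mixture Pp Tp w l.
Proof.
rewrite /gem_mixture.
pose u j := (Pp j w * (Tp j w == l)%:R)%:E.
have u0 j : (0 <= u j)%E by rewrite lee_fin mulr_ge0.
have uE n : (\sum_(0 <= j < n) u j)%E = (mixn n (Pp ^~ w) (Tp ^~ w) l)%:E.
  by rewrite sumEFin big_mkord.
have cu : cvgn (fun n => \sum_(0 <= j < n) u j)%E.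
  by apply: is_cvg_nneseries => n _ _; exact: u0.
have le1 : (\sum_(j <oo) u j <= 1%:E)%E.
  apply: lime_le => //; apply: nearW => n; rewrite uE lee_fin.
  by have /andP[] := unit_box_mixn_gem n w l.
have fu : (\sum_(j <oo) u j)%E \is a fin_num.
  rewrite ge0_fin_numE; first exact: le_lt_trans le1 (ltry _).
  by apply: nneseries_ge0 => n _ _; exact: u0.
have -> : (fun n => mixn n (Pp ^~ w) (Tp ^~ w) l) =
    fine \o (fun n => \sum_(0 <= j < n) u j)%E.
  by apply/funext => n; rewrite /= uE.
by apply: fine_cvg; rewrite fineK.
Qed.

Lemma unit_box_gem w : unit_box (gem_mixture Pp Tp w).
Proof.
move=> l; have H := @mixn_gem_cvg w l; apply/andP; split.
  apply: (cvgr_to_ge H); apply: nearW => n.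
  by have /andP[] := unit_box_mixn_gem n w l.
apply: (cvgr_to_le H); apply: nearW => n.
by have /andP[] := unit_box_mixn_gem n w l.
Qed.

Definition gem_mean (h : (X -> R) -> X -> R) : R :=
  \int[P]_w h (gem_mixture Pp Tp w) (Tp 0%N w).

Lemma gem_mean_cvg h (C L : R) : lipclass F C L h ->
  measurable_fun setT (fun w => h (gem_mixture Pp Tp w) (Tp 0%N w)) /\
  mix_mean P Pp Tp n.+1 h @[n --> \oo] --> gem_mean h.
Proof.
move=> hl; have [hC hL] := hl.
have [] := @cvg_Rintegral_bounded _ _ _ P setT
  (fun n w => h (mixn n.+1 (Pp ^~ w) (Tp ^~ w)) (Tp 0%N w))
  (fun w => h (gem_mixture Pp Tp w) (Tp 0%N w)) C measurableT _ _ _ => //.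
- by move=> n; have [] := mix_mean_indep x0 iX PpE mc ind n hl.
- by move=> n w; apply: ge0_le_norm; exact: hC.
move=> w; apply: (@lip_cvg _ _ F L (h ^~ (Tp 0%N w))) => [v v'|l]; first exact: hL.
have := @mixn_gem_cvg w l.
by rewrite -(cvg_shiftS (fun n => mixn n (Pp ^~ w) (Tp ^~ w) l)).
Qed.

Lemma gem_mean_int h (C L : R) : lipclass F C L h ->
  P.-integrable setT (EFin \o (fun w => h (gem_mixture Pp Tp w) (Tp 0%N w))).
Proof.
move=> hl; apply: (@bounded_Rintegrable _ _ _ _ _ _ C) => //.
  by have [] := gem_mean_cvg hl.
by move=> w; apply: ge0_le_norm; exact: hl.1.
Qed.

Lemma gem_mean_bound h (C L : R) : lipclass F C L h -> 0 <= gem_mean h <= C.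
Proof.
move=> hl; apply: Rintegral_bound; first by have [] := gem_mean_cvg hl.
by move=> w; exact: hl.1.
Qed.

Lemma gem_mean_dist h g (C L e : R) : lipclass F C L h -> lipclass F C L g ->
  (forall v i, unit_box v -> `|h v i - g v i| <= e) ->
  `|gem_mean h - gem_mean g| <= e.
Proof.
move=> hl gl hg; apply: (@Rintegral_dist _ _ _ _ _ _ C).
- by have [] := gem_mean_cvg hl.
- by have [] := gem_mean_cvg gl.
- by move=> w; exact: hl.1.
- by move=> w; exact: gl.1.
- by move=> w; apply: hg; exact: unit_box_gem.
Qed.

Lemma gem_mean_step h (C L r : R) : 0 < r -> r < 1 -> 0 <= L ->
  lipclass F C L h ->
  `|gem_mean h - (powR r theta * gem_mean (slide r h) +
     (1 - powR r theta) * gem_mean (mean_field theta Q mu h))| <=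
  (1 - powR r theta) * (L * ((1 - r) * (size F)%:R)).
Proof.
move=> r0 r1 L0 hl.
have [_ c1] := gem_mean_cvg hl.
have [_ c2] := gem_mean_cvg (lipclass_slide (ltW r0) (ltW r1) L0 hl).
have [_ c3] := gem_mean_cvg (lipclass_mean_field theta_gt0 sQ sm hl).
rewrite -(cvg_shiftS (fun n => mix_mean P Pp Tp n.+1 h)) in c1.
rewrite -(cvg_shiftS (fun n => mix_mean P Pp Tp n.+1 (slide r h))) in c2.
have H : `|mix_mean P Pp Tp n.+2 h - (powR r theta * mix_mean P Pp Tp n.+2 (slide r h) +
     (1 - powR r theta) * mix_mean P Pp Tp n.+1 (mean_field theta Q mu h))| @[n --> \oo] -->
  `|gem_mean h - (powR r theta * gem_mean (slide r h) +
     (1 - powR r theta) * gem_mean (mean_field theta Q mu h))|.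
  apply: cvg_norm; apply: cvgB c1 _.
  by apply: cvgD; apply: cvgM; [exact: cvg_cst|exact: c2|exact: cvg_cst|exact: c3].
apply: (cvgr_to_le H); apply: nearW => n.
exact: (mix_mean_step x0 theta_gt0 sQ sm iX X01 PpE mc ind n r0 r1 L0 hl).
Qed.

(** The term [theta * L * size F] occurs twice, once for dropping the first stick and once for
    ignoring the update of [v] when the chain moves. The term [C * (theta * (1 + theta))] is the gap
    between [r^theta] and [1 - theta/(n+1)]. *)
Lemma gem_almost_invariant n h (C L : R) : 0 <= C -> 0 <= L -> (M <= n)%N ->
  theta <= n.+1%:R -> lipclass F C L h ->
  `|gem_mean h - gem_mean (step (Kn (Gtp theta Q mu) M n.+1) n.+1 h)| <=
  (2 * theta * L * (size F)%:R + C * (theta * (1 + theta))) / n.+1%:R ^+ 2.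
Proof.
move=> C0 L0 Mn tn hl; have [hC hL] := hl.
set D : R := (size F)%:R; have D0 : 0 <= D by [].
(* This [r] makes [slide r] coincide with the update [push n.+1] at an unchanged state. *)
set r : R := n.+1%:R / n.+2%:R.
have r0 : 0 < r by rewrite divr_gt0.
have r1 : r < 1 by rewrite ltr_pdivrMr// mul1r ltr_nat.
have rE : 1 - r = n.+2%:R^-1.
  by rewrite /r -[X in X - _](@divff _ n.+2%:R) ?pnatr_eq0// -mulrBl -natrB// subSnn mul1r.
have sl := lipclass_slide (ltW r0) (ltW r1) L0 hl.
have ml := lipclass_mean_field theta_gt0 sQ sm hl.
have slE v i : slide r h v i = h (push n.+1 v i) i.
  rewrite /slide; congr (h _ _); apply/funext => l.
  by rewrite rE /r /push /idm mulrDl mulrAC [_^-1 * _]mulrC.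
have [a aE] : exists a, a = theta / n.+1%:R by exists (theta / n.+1%:R).
have a0 : 0 <= a by rewrite aE divr_ge0// ltW.
have a1 : a <= 1 by rewrite aE ler_pdivrMr// mul1r.
pose g : (X -> R) -> X -> R :=
  fun v i => (1 - a) * slide r h v i + a * mean_field theta Q mu h v i.
have gl : lipclass F C L g.
  split=> [v i|v w i].
    have /andP[s0 s1] := sl.1 v i; have /andP[m0 m1] := ml.1 v i.
    rewrite /g; apply/andP; split.
      by apply: addr_ge0; apply: mulr_ge0 => //; rewrite subr_ge0.
    rewrite (_ : C = (1 - a) * C + a * C); last by ring.
    by rewrite lerD// ler_wpM2l ?subr_ge0.
  rewrite /g opprD addrACA -!mulrBr.
  apply: le_trans (ler_normD _ _) _; rewrite !normrM.
  rewrite (ger0_norm a0) ger0_norm ?subr_ge0//.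
  rewrite (_ : L * _ = (1 - a) * (L * sdist F v w) + a * (L * sdist F v w)); last by ring.
  by rewrite lerD// ler_wpM2l ?subr_ge0//; [exact: sl.2|exact: ml.2].
have gE : gem_mean g = (1 - a) * gem_mean (slide r h)
    + a * gem_mean (mean_field theta Q mu h).
  rewrite /gem_mean /g.
  have Is := gem_mean_int sl; have Im := gem_mean_int ml.
  rewrite RintegralD//; [by rewrite !RintegralZl| |].
  - have := @integrableZl _ _ _ P setT measurableT (1 - a) _ Is.
    by apply: eq_integrable => // w _; rewrite /= EFinM.
  - have := @integrableZl _ _ _ P setT measurableT a _ Im.
    by apply: eq_integrable => // w _; rewrite /= EFinM.
have pK i := prob_vec_Kn theta_gt0 sQ sm M_big n.+1 i.
have stl : lipclass F C L (step (Kn (Gtp theta Q mu) M n.+1) n.+1 h).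
  apply: lipclassW (lipclass_step n.+1 pK L0 hl).
  by rewrite ler_piMr// (ltW r1).
have H1 : `|gem_mean g - gem_mean (step (Kn (Gtp theta Q mu) M n.+1) n.+1 h)|
    <= a * (L * (n.+2%:R^-1 * D)).
  apply: (gem_mean_dist gl stl) => v i v01.
  rewrite /step (@ev_Kn _ _ _ _ _ _ theta_gt0 sQ sm M_big n.+1 i _ C)//.
  rewrite /g slE -aE.
  rewrite opprD addrACA subrr add0r -mulrBr normrM (ger0_norm a0) ler_wpM2l//.
  apply: (@ev_dist _ _ _ _ _ C) => // [|j]; first exact: prob_vec_Qtp.
  rewrite distrC; apply: le_trans (hL _ _ _) _; rewrite ler_wpM2l//.
  exact: sdist_push_id.
have H2 := gem_mean_step r0 r1 L0 hl.
have /andP[P1 P2] := powR_ratio_bounds n theta_gt0.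
rewrite -/r -aE in P1 P2 H2.
have b1 := gem_mean_bound sl; have b2 := gem_mean_bound ml.
rewrite rE in H2.
have H3 : (1 - powR r theta) * (L * (n.+2%:R^-1 * D)) <= a * (L * (n.+2%:R^-1 * D)).
  by apply: ler_wpM2r; [rewrite !mulr_ge0|lra].
have H4 : `|(powR r theta - (1 - a)) * (gem_mean (slide r h) - gem_mean (mean_field theta Q mu h))|
    <= theta * (1 + theta) / n.+1%:R ^+ 2 * C.
  rewrite normrM; apply: ler_pM => //.
    by rewrite ger0_norm ?subr_ge0// lerBlDl.
  by rewrite ler_norml; lra.
have H5 : a * (L * (n.+2%:R^-1 * D)) <= theta * L * D / n.+1%:R ^+ 2.
  rewrite aE expr2 invfM.
  rewrite (_ : theta * L * D * _ = theta / n.+1%:R * (L * (n.+1%:R^-1 * D))); last by ring.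
  apply: ler_wpM2l; first by rewrite -aE.
  apply: ler_wpM2l => //; apply: ler_wpM2r => //.
  by rewrite lef_pV2 ?posrE// ler_nat.
have -> : (2 * theta * L * D + C * (theta * (1 + theta))) / n.+1%:R ^+ 2 =
    2 * (theta * L * D / n.+1%:R ^+ 2) + theta * (1 + theta) / n.+1%:R ^+ 2 * C.
  by ring.
move: gE H1 H2 H3 H4 H5.
move: (gem_mean h) (gem_mean g) (gem_mean (step _ _ _)) (gem_mean (slide r h))
  (gem_mean (mean_field theta Q mu h)) (powR r theta) => z gz st s m rho -> H1 H2 H3 H4 H5.
(* Three errors: the stick identity, the replacement of [r^theta] by [1 - a], and the passage from
   the averaged function [g] to the true step. *)
have -> : z - st = (z - (rho * s + (1 - rho) * m)) + (rho - (1 - a)) * (s - m)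
   + ((1 - a) * s + a * m - st) by ring.
apply: le_trans (ler_normD _ _) _.
have N := le_trans (ler_normD (z - (rho * s + (1 - rho) * m))
  ((rho - (1 - a)) * (s - m))) (lerD H2 H4).
apply: le_trans (lerD N H1) _.
rewrite addrAC lerD2r mulr_natl mulr2n.
by apply: lerD => //; exact: le_trans H3 H5.
Qed.

End gem_limit.

(** * Null sets, inf-convolutions and clipping *)

Section off_null_sets.
Import HBNNSimple.
Context d (T : measurableType d) (R : realType) (mu : {measure set T -> \bar R})
  (N : set T).
Hypotheses (mN : measurable N) (N0 : mu N = 0%E).

(** A simple function below [f], set to zero on [N], stays below [g] and keeps its integral. *)
Let ge0_integral_off_null_le (f g : T -> \bar R) :
  (forall w, 0 <= f w)%E -> (forall w, 0 <= g w)%E ->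
  (forall w, ~ N w -> f w = g w) -> (\int[mu]_w f w <= \int[mu]_w g w)%E.
Proof.
move=> f0 g0 fg; rewrite ge0_integralTE// [leRHS]ge0_integralTE//.
apply: ge_ereal_sup => _ [h hf <-].
have mNC : measurable (~` N) by exact: measurableC.
have -> : sintegral mu h = sintegral mu (proj_nnsfun h mNC).
  rewrite -mrestrict -(integral_nnsfun mu mNC h).
  transitivity (\int[mu]_w (h w)%:E)%E.
    by rewrite (integral_nnsfun mu measurableT h) patch_setT.
  rewrite (ge0_negligible_integral mN)// ?setTD//.
    by apply/measurable_EFinP; exact: measurable_funP.
  by move=> x _; rewrite lee_fin; exact: fun_ge0.
apply: ereal_sup_ubound; exists (proj_nnsfun h mNC) => //= x.
rewrite /= /mindic indicE.
case: (pselect (N x)) => Nx.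
  by rewrite memNset ?mulr0// => /(_ Nx).
by rewrite mem_set// mulr1 -fg//; exact: hf.
Qed.

(* No measurability is required: the integral is defined by approximation from below. *)
Lemma integral_eq_off_null (f g : T -> \bar R) :
  (forall w, ~ N w -> f w = g w) -> (\int[mu]_w f w = \int[mu]_w g w)%E.
Proof.
move=> fg; rewrite integralE [RHS]integralE.
have E (a b : T -> \bar R) : (forall w, 0 <= a w)%E -> (forall w, 0 <= b w)%E ->
    (forall w, ~ N w -> a w = b w) -> (\int[mu]_w a w = \int[mu]_w b w)%E.
  move=> a0 b0 ab; apply/eqP; rewrite eq_le !ge0_integral_off_null_le//.
  by move=> w Nw; rewrite ab.
congr (_ - _)%E; apply: E => // w Nw.
- by rewrite !funeposE fg.
- by rewrite !funenegE fg.
Qed.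

Lemma measure_eq_off_null (A B : set T) : measurable A -> measurable B ->
  (forall w, ~ N w -> A w <-> B w) -> mu A = mu B.
Proof.
move=> mA mB AB; rewrite -(setIT A) -(setIT B) -!integral_indic//.
apply: integral_eq_off_null => w /AB H; congr (_%:E); rewrite !indicE; congr (_%:R).
by congr nat_of_bool; apply/idP/idP; rewrite !inE => /H.
Qed.

End off_null_sets.

Lemma ptws_cvg (R : realType) (X : Type) (v_ : nat -> {ptws X -> R})
    (v : {ptws X -> R}) :
  (forall x, v_ n x @[n --> \oo] --> v x) -> v_ @ \oo --> v.
Proof.
move=> H; apply/cvg_sup => x.
rewrite cvg_image; last first.
  by rewrite eqEsubset; split=> [//|y _]; exists (fun=> y).
move=> W /(H x) HW; exists ((fun g => g x) @^-1` W) => //.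
rewrite eqEsubset; split => [y [? + <-]//|y Wy].
by exists (fun=> y).
Qed.

Section inf_convolution.
Context (R : realType) (X : countType) (f : (X -> R) -> R) (C : R).
Hypothesis fC : forall v, 0 <= f v <= C.

Definition boxes (m : nat) : seq X := pmap (@pickle_inv X) (iota 0 m).

(** The index [m] is both the Lipschitz constant and the length of the enumeration in [boxes], so
    that every coordinate is eventually penalized, with a weight tending to infinity. *)
Definition infconv (m : nat) (v : X -> R) : R :=
  inf [set f w + m%:R * sdist (boxes m) v w | w in [set: X -> R]].

Let f0 v : 0 <= f v. Proof. by case/andP: (fC v). Qed.

Let lbd m v : has_lbound [set f w + m%:R * sdist (boxes m) v w | w in [set: X -> R]].
Proof.
by exists 0 => _ [w _ <-]; rewrite addr_ge0// mulr_ge0// sdist_ge0.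
Qed.

Let nonempty m v : [set f w + m%:R * sdist (boxes m) v w | w in [set: X -> R]] !=set0.
Proof. by exists (f v + m%:R * sdist (boxes m) v v); exists v. Qed.

Lemma infconv_le m v : infconv m v <= f v.
Proof.
apply: (le_trans (ge_inf (lbd m v) _)); first by exists v.
by rewrite /sdist big1 ?mulr0 ?addr0// => x _; rewrite subrr normr0.
Qed.

Lemma infconv_bound m v : 0 <= infconv m v <= C.
Proof.
apply/andP; split; last first.
  by apply: le_trans (infconv_le m v) _; case/andP: (fC v).
apply: lb_le_inf; first exact: nonempty.
by move=> _ [w _ <-]; rewrite addr_ge0// mulr_ge0// sdist_ge0.
Qed.

Let infconv_lip1 m v v' :
  infconv m v - m%:R * sdist (boxes m) v v' <= infconv m v'.
Proof.
apply: lb_le_inf; first exact: nonempty.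
move=> _ [w _ <-]; rewrite lerBlDr.
apply: (le_trans (ge_inf (lbd m v) _)); first by exists w.
rewrite -addrA lerD2l -mulrDr ler_wpM2l// /sdist -big_split/=.
by apply: ler_sum => x _; rewrite addrC -[in X in X <= _](subrKA (v' x)) ler_normD.
Qed.

Lemma infconv_lip m v v' :
  `|infconv m v - infconv m v'| <= m%:R * sdist (boxes m) v v'.
Proof.
have H1 := infconv_lip1 m v v'; have H2 := infconv_lip1 m v' v.
have E : sdist (boxes m) v' v = sdist (boxes m) v v'.
  by apply: eq_bigr => x _; rewrite distrC.
by rewrite ler_distl -lerBlDr; move: H1 H2; rewrite E; lra.
Qed.

Hypothesis f_seqcont : forall (v_ : nat -> X -> R) v,
  (forall x, v_ n x @[n --> \oo] --> v x) -> f (v_ n) @[n --> \oo] --> f v.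

(** A near-minimizer [w_m] with slack [1/(m+1)] pays a penalty of at most [C + 1], so each of its
    coordinates converges to that of [v]. Continuity then squeezes the infimum between
    [f (w_m) - 1/(m+1)] and [f v]. *)
Lemma infconv_cvg v : infconv m v @[m --> \oo] --> f v.
Proof.
have /choice [w_ Hw] m : exists w,
    f w + m%:R * sdist (boxes m) v w <= infconv m v + @harmonic R m.
  have := inf_adherent (harmonic_gt0 m : 0 < @harmonic R m)
    (conj (nonempty m v) (lbd m v)).
  by move=> [_ [w _ <-] /ltW H]; exists w.
have sd0 m : 0 <= m%:R * sdist (boxes m) v (w_ m) by rewrite mulr_ge0// sdist_ge0.
have fw : f (w_ n) @[n --> \oo] --> f v.
  apply: f_seqcont => x; apply/cvgrPdist_le => e e0.
  have [n1 Hn1] : exists n1, forall m, (n1 <= m)%N -> C + 1 <= m%:R * e.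
    exists (Num.Def.archi_bound ((C + 1) / e)) => m Hm.
    have C0 : 0 <= C by case/andP: (fC v) => a b; exact: le_trans b.
    rewrite -ler_pdivrMr//; apply: ltW; apply: lt_le_trans (archi_boundP _) _.
      by rewrite divr_ge0 ?addr_ge0// ltW.
    by rewrite ler_nat.
  exists (maxn (pickle x).+1 n1.+1) => // m /=; rewrite geq_max => /andP[xm n1m].
  have m0 : 0 < m%:R :> R by rewrite ltr0n (leq_trans _ n1m).
  have xb : x \in boxes m.
    by rewrite /boxes mem_pmap; apply/mapP; exists (pickle x);
      rewrite ?pickleK_inv// mem_iota.
  have H : `|v x - w_ m x| <= sdist (boxes m) v (w_ m).
    by rewrite /sdist (big_rem x)//= lerDl sumr_ge0.
  apply: (le_trans H); rewrite -(ler_pM2l m0).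
  apply: le_trans (Hn1 m (ltnW n1m)).
  have := Hw m; have /andP[_ i1] := infconv_bound m v; have := f0 (w_ m).
  have : @harmonic R m <= 1 by rewrite /harmonic/= invf_le1// ler1n.
  lra.
have lo : f (w_ n) - @harmonic R n @[n --> \oo] --> f v.
  by rewrite -[X in _ --> X]subr0; apply: cvgB => //; exact: cvg_harmonic.
apply: (squeeze_cvgr _ lo (cvg_cst (f v))); apply: nearW => m.
rewrite infconv_le andbT lerBlDr; apply: le_trans (Hw m).
by rewrite lerDl.
Qed.

End inf_convolution.

Section clipping.
Context (R : realType) d (Omega : measurableType d) (P : probability Omega R)
  (theta : R) (Xb : nat -> Omega -> R).
Hypothesis iX : iid_beta1 P theta Xb.

(** The value outside the interval only has to lie inside it: the Beta law is an integral over []0,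
    1[], so clipping leaves [iid_beta1] intact. *)
Definition clip01 (x : R) : R := if 0 < x < 1 then x else 2^-1.

Lemma clip01_itv x : 0 < clip01 x < 1.
Proof. by rewrite /clip01; case: ifPn => //; lra. Qed.

Lemma measurable_clip01 : measurable_fun setT clip01.
Proof.
move=> _ B mB; rewrite setTI.
have -> : clip01 @^-1` B = (B `&` `]0, 1[%classic) `|`
    (~` `]0, 1[%classic `&` (if `[< B 2^-1 >] then setT else set0)).
  apply/seteqP; split=> x /=; rewrite /clip01 in_itv/=;
    have [x01|x01] := boolP (0 < x < 1).
  - by left.
  - by move=> Bx; right; split=> //; rewrite asboolT.
  - by case=> [[]//|[]].
  - by case=> [[]//|[_]]; case: ifPn => // /asboolP.
have mI : measurable (`]0, 1[%classic : set R) by exact: measurable_itv.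
apply: measurableU; first exact: measurableI.
by apply: measurableI; [exact: measurableC|case: ifPn].
Qed.

Let itv01 : set R := `]0, 1[%classic.

Lemma iid_beta1_clip : iid_beta1 P theta (fun k w => clip01 (Xb k w)).
Proof.
split=> [k|n B mB].
  by apply: measurableT_comp; [exact: measurable_clip01|exact: iX.1].
have mB' k : measurable (clip01 @^-1` B k).
  by rewrite -[_ @^-1` _]setTI; exact: measurable_clip01.
rewrite (iX.2 n _ mB'); apply: eq_bigr => k _; rewrite /beta1_law.
congr (integral _ _ _); apply/seteqP; split=> x /=; rewrite in_itv/= /clip01;
  by move=> [H x01]; move: H; rewrite x01.
Qed.

Definition off01 : set Omega := \bigcup_k (Xb k @^-1` (~` itv01)).

Let moff k : measurable (Xb k @^-1` (~` itv01)).
Proof.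
rewrite -[_ @^-1` _]setTI; apply: iX.1 => //.
by apply: measurableC; exact: measurable_itv.
Qed.

Lemma measurable_off01 : measurable off01.
Proof. by apply: bigcup_measurable => k _. Qed.

Let mitv : measurable itv01. Proof. exact: measurable_itv. Qed.

(** The law [beta1_law] gives []0, 1[] the same mass as the whole line, and the latter is 1 since
    the product formula holds for the full event. *)
Lemma off01_null : P off01 = 0%E.
Proof.
have H n : P [set w | forall k, (k <= n)%N -> itv01 (Xb k w)] = 1%E.
  rewrite (iX.2 n (fun=> itv01) (fun=> mitv)).
  rewrite (eq_bigr (fun k : 'I_n.+1 => beta1_law theta setT)) => [|k _]; last first.
    by rewrite /beta1_law setTI setIid.
  rewrite -(iX.2 n (fun=> setT) (fun=> measurableT)).
  rewrite (_ : [set _ | _] = setT) ?probability_setT//.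
  by apply/seteqP; split.
have N k : P.-negligible (Xb k @^-1` (~` itv01)).
  apply/negligibleP; first exact: moff.
  have mE : measurable (Xb k @^-1` itv01).
    by rewrite -[_ @^-1` _]setTI; exact: iX.1.
  transitivity (1 - P (Xb k @^-1` itv01))%E.
    by rewrite -preimage_setC; exact: probability_setC.
  rewrite (_ : P (Xb k @^-1` itv01) = 1%E) ?subee//.
  apply/eqP; rewrite eq_le probability_le1//= -(H k).
  apply: le_measure; rewrite ?inE//; last by move=> w /= /(_ k (leqnn k)).
  rewrite (_ : [set _ | _] = \bigcap_(j in [set j | (j <= k)%N]) (Xb j @^-1` itv01)).
    apply: bigcap_measurableType => // j _.
    by rewrite -[_ @^-1` _]setTI; exact: iX.1.
  by apply/seteqP; split=> [w Hw j jk|w Hw j jk]; exact: Hw.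
by apply/negligibleP; [exact: measurable_off01|exact: negligible_bigcup].
Qed.

Lemma clip01_off w : ~ off01 w -> forall k, clip01 (Xb k w) = Xb k w.
Proof.
move=> Nw k; rewrite /clip01; case: ifPn => // H; exfalso; apply: Nw.
by exists k => //=; rewrite /itv01/= in_itv/=; exact/negP.
Qed.

End clipping.

(** * Weak convergence *)

Section weak_limit.
Context (R : realType) (X : countType) (x0 : X) (theta : R) (Q : X -> X -> R)
  (mu : X -> R) (M : nat) d (Omega : measurableType d) (P : probability Omega R)
  (Pp Xb : nat -> Omega -> R) (Tp : nat -> Omega -> X) (pi : X -> R)
  d' (Omega' : measurableType d') (P' : probability Omega' R)
  (T : nat -> Omega' -> X).
Hypotheses (theta_gt0 : 0 < theta) (sQ : stochastic Q) (sm : stationary Q mu).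
Hypotheses (iX : iid_beta1 P theta Xb) (X01 : forall k w, 0 < Xb k w < 1).
Hypothesis PpE : forall j w, Pp j w = stick (Xb ^~ w) j.
Hypotheses (mc : markov_chain P mu (fun _ => Q) Tp) (ind : indep_seq P Tp Pp).
Hypothesis M_big : M_threshold (Gtp theta Q mu) < M%:R.
Hypothesis ppi : prob_vec pi.
Hypothesis pi_cvg : forall l, (fun n => vpow pi (Qtp theta Q mu) n l) @ \oo --> mu l.
Hypothesis mc' : markov_chain P' pi (fun k => Kn (Gtp theta Q mu) M k.+1) T.

Let mT k x : measurable (T k @^-1` [set x]). Proof. by case: mc'. Qed.
Let mTp k x : measurable (Tp k @^-1` [set x]). Proof. by case: mc. Qed.

Lemma occ_fun_cvg (F : seq X) (C L : R) h : 0 <= C -> 0 <= L ->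
  lipclass F C L h -> occ_fun P' T n h @[n --> \oo] --> gem_mean P Pp Tp h.
Proof.
move=> C0 L0 hl.
(* Beyond [n0] the kernel has left its idle phase and [theta/(n+1) <= 1]. *)
pose n0 := maxn M (Num.Def.archi_bound theta).
have tn n : (n0 <= n)%N -> theta <= n.+1%:R.
  move=> Hn; apply: (le_trans (ltW (archi_boundP (ltW theta_gt0)))).
  by rewrite ler_nat leqW// (leq_trans (leq_maxr _ _) Hn).
have pK n i := prob_vec_Kn theta_gt0 sQ sm M_big n i.
apply: (Lf_cvg (K := Kn (Gtp theta Q mu) M) pK (n0 := n0)
  (A := 2 * theta * L * (size F)%:R + C * (theta * (1 + theta))) _ _ L0 _ _ _ _ hl).
- move=> n g gC; exact: (occ_fun_step x0 theta_gt0 sQ sm M_big mc' n gC).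
- by rewrite addr_ge0// !mulr_ge0// ?addr_ge0// ltW.
- move=> n g n0n gl.
  apply: (gem_almost_invariant x0 theta_gt0 sQ sm iX X01 PpE mc ind M_big) => //.
    exact: leq_trans (leq_maxl _ _) n0n.
  exact: tn.
- move=> n g1 g2 e l1 l2 H.
  by apply: (occ_fun_dist x0 mc' n (C := C)) => //; [exact: l1.1|exact: l2.1].
- move=> g1 g2 e l1 l2 H.
  exact: (gem_mean_dist x0 iX X01 PpE mc ind l1 l2 H).
- move=> e e0.
  have [N HN] := chain_mixing x0 theta_gt0 sQ sm M_big ppi pi_cvg mc' C0 e0.
  exists N.+1 => -[//|n] Nn g gC.
  rewrite (_ : gem_mean P Pp Tp (fun=> g) = ev mu g); first exact: HN.
  apply: (@Rintegral_countable _ _ _ P _ (Tp 0%N) mu g C) => //.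
  exact: (init_law mc).
Qed.

Let E n (f : (X -> R) -> R) := \int[P']_w f (occupation R T n w).
Let Einf (f : (X -> R) -> R) := \int[P]_w f (gem_mixture Pp Tp w).

Let measurable_occ n (f : (X -> R) -> R) :
  measurable_fun setT (fun w => f (occupation R T n w)).
Proof.
under eq_fun do rewrite occupation_traj.
apply: (@measurable_fun_countable _ _ _ _ _ (traj T n) (fun s => f (occs R s))).
exact: (measurable_traj x0).
Qed.

Definition seq_continuous (f : (X -> R) -> R) : Prop :=
  forall (v_ : nat -> X -> R) v,
  (forall x, v_ n x @[n --> \oo] --> v x) -> f (v_ n) @[n --> \oo] --> f v.

Let liplift (f : (X -> R) -> R) (C : R) m : (forall v, 0 <= f v <= C) ->
  lipclass (boxes X m) C m%:R (fun v _ => infconv f m v).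
Proof.
by move=> fC; split=> [v _|v w _]; [exact: infconv_bound|exact: infconv_lip].
Qed.

Let measurable_gem_ge0 (f : (X -> R) -> R) (C : R) :
  (forall v, 0 <= f v <= C) -> seq_continuous f ->
  measurable_fun setT (fun w => f (gem_mixture Pp Tp w)) /\
  Einf (infconv f m) @[m --> \oo] --> Einf f.
Proof.
move=> fC fs.
have [] := @cvg_Rintegral_bounded _ _ _ P setT
  (fun m w => infconv f m (gem_mixture Pp Tp w))
  (fun w => f (gem_mixture Pp Tp w)) C measurableT _ _ _ => //.
- move=> m; have [] := gem_mean_cvg x0 iX X01 PpE mc ind (liplift m fC).
  by [].
- by move=> m w; apply: ge0_le_norm; exact: infconv_bound.
- by move=> w; exact: (infconv_cvg fC).
Qed.

(* Portmanteau: the Lipschitz inf-convolutions increase to [f]. *)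
Let lower_bound (f : (X -> R) -> R) (C e : R) : (forall v, 0 <= f v <= C) ->
  seq_continuous f -> 0 < e ->
  exists N, forall n, (N <= n)%N -> Einf f - e <= E n f.
Proof.
move=> fC fs e0.
have C0 : 0 <= C by case/andP: (fC (fun=> 0)) => a b; exact: le_trans b.
have e20 : 0 < e / 2 by rewrite divr_gt0.
have [_ /cvgrPdist_le/(_ _ e20) [m _ Hm]] := measurable_gem_ge0 fC fs.
have := occ_fun_cvg C0 (ler0n R m) (liplift m fC).
move/cvgrPdist_le => /(_ _ e20) [N _ HN]; exists N => n Nn.
have H1 := Hm m (leqnn m); have H2 := HN n Nn.
have H3 : E n (infconv f m) <= E n f.
  apply: le_Rintegral => //.
  - apply: (@bounded_Rintegrable _ _ _ _ _ _ C) => // w.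
    by apply: ge0_le_norm; exact: infconv_bound.
  - apply: (@bounded_Rintegrable _ _ _ _ _ _ C) => // w.
    exact: ge0_le_norm.
  - by move=> w _; exact: infconv_le.
move: H1 H2 H3; rewrite -/(Einf _) /=.
rewrite -[gem_mean _ _ _ _]/(Einf (infconv f m)).
rewrite -[occ_fun _ _ _ _]/(E n (infconv f m)).
by rewrite !ler_norml; lra.
Qed.

(** The one-sided bound is applied to [f + C] and to [C - f], both with values in [[0, 2 C]];
    together they give the two-sided limit. *)
Lemma weak_cvg (f : (X -> R) -> R) (C : R) : (forall v, `|f v| <= C) ->
  seq_continuous f ->
  [/\ (forall n, measurable_fun setT (fun w => f (occupation R T n w))),
   measurable_fun setT (fun w => f (gem_mixture Pp Tp w)) &
   \int[P']_w f (occupation R T n w) @[n --> \oo] -->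
     \int[P]_w f (gem_mixture Pp Tp w)].
Proof.
move=> fC fs.
have C0 : 0 <= C := le_trans (normr_ge0 _) (fC (fun=> 0)).
pose fp v := f v + C; pose fm v := C - f v.
have fpC v : 0 <= fp v <= C + C by have := fC v; rewrite ler_norml /fp; lra.
have fmC v : 0 <= fm v <= C + C by have := fC v; rewrite ler_norml /fm; lra.
have fps : seq_continuous fp.
  by move=> v_ v H; apply: cvgD; [exact: fs|exact: cvg_cst].
have fms : seq_continuous fm.
  by move=> v_ v H; apply: cvgB; [exact: cvg_cst|exact: fs].
have mg : measurable_fun setT (fun w => f (gem_mixture Pp Tp w)).
  have [mfp _] := measurable_gem_ge0 fpC fps.
  have -> : (fun w => f (gem_mixture Pp Tp w)) =
      (fun w => fp (gem_mixture Pp Tp w) - C).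
    by apply/funext => w; rewrite /fp addrK.
  by apply: measurable_funB => //; exact: measurable_cst.
split=> //.
have IE n : P'.-integrable setT (EFin \o (fun w => f (occupation R T n w))).
  by apply: (@bounded_Rintegrable _ _ _ _ _ _ C).
have Ig : P.-integrable setT (EFin \o (fun w => f (gem_mixture Pp Tp w))).
  by apply: (@bounded_Rintegrable _ _ _ _ _ _ C).
have cst1 dd (TT : measurableType dd) (PP : probability TT R) :
    PP.-integrable setT (EFin \o cst C) /\ \int[PP]_w C = C.
  split; first exact: (@bounded_Rintegrable _ _ _ _ _ (cst C) `|C|).
  rewrite Rintegral_cst// [X in fine X](_ : _ = 1%E) ?mulr1//.
  exact: probability_setT.
have [cI1 cI2] := cst1 _ _ P'; have [cg1 cg2] := cst1 _ _ P.
have Ep n : E n fp = E n f + C by rewrite /E /fp RintegralD//= cI2.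
have Em n : E n fm = C - E n f by rewrite /E /fm RintegralB//= cI2.
have gp : Einf fp = Einf f + C by rewrite /Einf /fp RintegralD//= cg2.
have gm : Einf fm = C - Einf f by rewrite /Einf /fm RintegralB//= cg2.
apply/cvgrPdist_le => e e0.
have [N1 H1] := lower_bound fpC fps e0; have [N2 H2] := lower_bound fmC fms e0.
exists (maxn N1 N2) => // n /=; rewrite geq_max => /andP[/H1 + /H2].
by rewrite Ep Em gp gm -/(E n f) -/(Einf f) ler_norml; lra.
Qed.

End weak_limit.

(** * Convergence of the occupation measures for arbitrary sticks *)

Theorem mainTheorem5 (R : realType) (X : countType) (theta : R)
  (Q : X -> X -> R) (mu : X -> R)
  (d : measure_display) (Omega : measurableType d) (P : probability Omega R)
  (Pp : nat -> Omega -> R) (Tp : nat -> Omega -> X)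
  (M : nat) (pi : X -> R)
  (d' : measure_display) (Omega' : measurableType d')
  (P' : probability Omega' R) (T : nat -> Omega' -> X) :
  0 < theta ->
  stochastic Q -> no_absorbing Q -> stationary Q mu ->
  GEM P theta Pp ->
  markov_chain P mu (fun _ => Q) Tp ->
  indep_seq P Tp Pp ->
  M_threshold (Gtp theta Q mu) < M%:R ->
  prob_vec pi ->
  (forall l, (fun n => vpow pi (Qtp theta Q mu) n l) @ \oo --> mu l) ->
  markov_chain P' pi (fun k => Kn (Gtp theta Q mu) M k.+1) T ->
  forall f : {ptws X -> R} -> R,
    continuous f -> (exists C : R, forall v, `|f v| <= C) ->
    (fun n => \int[P']_w (f (occupation R T n w))%:E)%E @ \oo -->
      (\int[P]_w (f (gem_mixture Pp Tp w))%:E)%E.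
Proof.
move=> theta_gt0 sQ _ sm [Xb [iX XbE]] mc ind M_big ppi pi_cvg mc' f fcont [C fC].
have [x0 _] : exists x : X, True.
  apply: contrapT => /forallNP X0; have := sm.1.2.
  rewrite esum1; last by move=> i; case: (X0 i).
  by move=> /eqP; rewrite eq_sym onee_eq0.
pose Xc k w := clip01 (Xb k w).
pose Pc j w := stick (Xc ^~ w) j.
have iXc : iid_beta1 P theta Xc := iid_beta1_clip iX.
have mN := measurable_off01 iX; have N0 := off01_null iX.
have PcE w : ~ off01 Xb w -> forall j, Pc j w = Pp j w.
  move=> Nw j; rewrite /Pc /Xc /stick XbE (clip01_off Nw); congr (_ * _).
  by apply: eq_bigr => i _; rewrite (clip01_off Nw).
have mP (Y : nat -> Omega -> R) (Z : nat -> Omega -> R) :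
    (forall k, measurable_fun setT (Z k)) ->
    (forall j w, Y j w = Z j w * \prod_(i < j) (1 - Z i w)) ->
    forall k, measurable_fun setT (Y k).
  move=> mZ YE k; rewrite (funext (YE k)); apply: measurable_funM; first exact: mZ.
  elim: k => [|k IH].
    by under eq_fun do rewrite big_ord0; exact: measurable_cst.
  under eq_fun do rewrite big_ord_recr; apply: measurable_funM => //=.
  by apply: measurable_funB; [exact: measurable_cst|exact: mZ].
have mPp := mP Pp Xb iX.1 XbE.
have mPc := mP Pc Xc iXc.1 (fun _ _ => erefl).
(* Independence is known for [Pp] and has to be transferred to the clipped sequence: the events for
   the two differ only inside the null set [off01 Xb]. *)
have indc : indep_seq P Tp Pc.
  move=> n x B mB A Cc.
  have mA : measurable A.
    rewrite (_ : A = \bigcap_(k in [set k | (k <= n)%N]) (Tp k @^-1` [set x k])).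
      by apply: bigcap_measurableType => // k _; exact: mc.1.
    by apply/seteqP; split=> [w H k kn|w H k kn]; exact: H.
  have mC (Y : nat -> Omega -> R) : (forall k, measurable_fun setT (Y k)) ->
      measurable [set w | forall k, (k <= n)%N -> B k (Y k w)].
    move=> mY; rewrite (_ : [set _ | _] =
        \bigcap_(k in [set k | (k <= n)%N]) (Y k @^-1` B k)).
      by apply: bigcap_measurableType => // k _; rewrite -[_ @^-1` _]setTI; exact: mY.
    by apply/seteqP; split=> [w H k kn|w H k kn]; exact: H.
  have mCc := mC _ mPc; have mCp := mC _ mPp.
  have eqC w : ~ off01 Xb w -> Cc w <-> (forall k, (k <= n)%N -> B k (Pp k w)).
    by move=> Nw; split=> H k kn; have := H k kn; rewrite /= PcE.
  rewrite (measure_eq_off_null mN N0 mCc mCp eqC).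
  rewrite -(ind n x B mB); apply: (measure_eq_off_null mN N0).
  - exact: measurableI.
  - exact: measurableI.
  - by move=> w Nw; split=> -[Aw Cw]; split=> //; apply/(eqC w Nw).
have fs : seq_continuous f.
  by move=> v_ v H; exact: (cvg_comp _ _ (@ptws_cvg R X v_ v H) (fcont v)).
have [mo mg W] := weak_cvg x0 theta_gt0 sQ sm iXc (fun k w => clip01_itv (Xb k w))
  (fun _ _ => erefl) mc indc M_big ppi pi_cvg mc' fC fs.
(* Off the null set the two mixtures coincide, so the limit can be returned to the original [Pp]. *)
have -> : (\int[P]_w (f (gem_mixture Pp Tp w))%:E =
    \int[P]_w (f (gem_mixture Pc Tp w))%:E)%E.
  apply: (integral_eq_off_null mN N0) => w Nw; congr (f _)%:E.
  apply/funext => l; rewrite /gem_mixture; congr fine; apply: eq_eseriesr => j _.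
  by rewrite PcE.
have IE n : P'.-integrable setT (EFin \o (fun w => f (occupation R T n w))).
  by apply: (@bounded_Rintegrable _ _ _ _ _ _ C).
have Ig : P.-integrable setT (EFin \o (fun w => f (gem_mixture Pc Tp w))).
  by apply: (@bounded_Rintegrable _ _ _ _ _ _ C).
have fg := integrable_fin_num measurableT Ig.
rewrite -(fineK fg); apply: cvg_EFin; last exact: W.
by apply: nearW => n; exact: (integrable_fin_num measurableT (IE n)).
Qed.
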